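(* Let $p$ be a prime, let $n$ be a perfect square, and let $a=(a_{x,y})_{x,y\in[\sqrt n]}$ be an $n$-dimensional vector over $\mathbb{F}_p$ viewed as a $\sqrt n\times\sqrt n$ array, where $[k]=\{0,\dots,k-1\}$. Let $f\in\mathbb{F}_p[X,Y]$ be the unique polynomial of degree at most $\sqrt n-1$ in each variable with $f(x,y)=a_{x,y}$ for all $(x,y)\in[\sqrt n]\times[\sqrt n]$. In the non-interactive protocol for $F_2(a)=\sum_{x,y}a_{x,y}^2$ described in the context, the honest prover's message is the univariate polynomial $s(X)=\sum_{y\in[\sqrt n]}f(X,y)^2$ of degree at most $2(\sqrt n-1)$, specified by its values $s(0),s(1),\dots,s(2\sqrt n-1)$. Then the honest prover can compute this message, given $a$, using $O(n\log n)$ arithmetic operations on numbers of bit-complexity $O(\log n+\log p)$.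
   Context: The protocol: a verifier $\mathcal V$ observes the data (as a stream of updates $(i,\delta)$ to the frequency vector $a$) and picks a uniformly random $r\in\mathbb{F}_p$, computing $f(r,y)$ for every $y\in[\sqrt n]$ while reading the stream. The prover $\mathcal P$ then sends a polynomial $s$ of degree at most $2(\sqrt n-1)$ claimed to equal $\sum_{y\in[\sqrt n]}f(X,y)^2$; $\mathcal V$ checks $s(r)=\sum_{y\in[\sqrt n]}f(r,y)^2$ and, if so, outputs $\sum_{x\in[\sqrt n]}s(x)$ as $F_2(a)$. The ''honest prover'' is the prover that sends exactly $s(X)=\sum_{y}f(X,y)^2$. *)

(* Defs.v *)
From HB Require Import structures.
From mathcomp Require Import all_boot all_order all_algebra.

Set Implicit Arguments.
Unset Strict Implicit.
Unset Printing Implicit Defensive.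

Import Order.TTheory GRing.Theory Num.Theory.
Local Open Scope ring_scope.

(** Algorithms are the programs of a fixed imperative language over unbounded
    integers, with integer variables and integer arrays.  It is a random access
    machine with unit-cost arithmetic: a run is charged one unit for every
    operation, memory access and test, and is only legal when every number it
    handles, including addresses and intermediate results, has at most [W]
    bits. *)

(** [Le] and [Eq] return 0 or 1.  [Div] and [Mod] are the Euclidean division of
    [intdiv], so [x / 0 = 0] and [x mod 0 = x]. *)
Inductive binop := Add | Sub | Mul | Div | Mod | Le | Eq.

Definition eval_binop (o : binop) (x y : int) : int :=
  match o with
  | Add => x + y
  | Sub => x - y
  | Mul => x * y
  | Div => (x %/ y)%Z
  | Mod => (x %% y)%Z
  | Le => if x <= y then 1 else 0
  | Eq => if x == y then 1 else 0
  end.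

(** [floor (sqrt x)] for [0 <= x], and 0 for negative [x].  The square root is
    counted among the arithmetic operations: it yields fixed-point roots of
    unity, accurate to [O(log n + log p)] bits, in a number of operations that
    does not depend on [p]. *)
Definition isqrt (x : int) : int :=
  if x is Posz k then (\max_(i < k.+1 | (i ^ 2 <= k)%N) (i : nat))%:Z else 0.

Inductive expr :=
  | Const of int
  | Var of nat
  | Get of nat & expr
  | Sqrt of expr
  | Bin of binop & expr & expr.

Record state := State { vars : nat -> int; arrs : nat -> int -> int }.

Fixpoint eval (st : state) (e : expr) : int :=
  match e with
  | Const k => k
  | Var x => vars st x
  | Get b i => arrs st b (eval st i)
  | Sqrt e1 => isqrt (eval st e1)
  | Bin o e1 e2 => eval_binop o (eval st e1) (eval st e2)
  end.

Fixpoint expr_cost (e : expr) : nat :=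
  match e with
  | Const _ | Var _ => 1
  | Get _ e1 | Sqrt e1 => (expr_cost e1).+1
  | Bin _ e1 e2 => (expr_cost e1 + expr_cost e2).+1
  end.

Definition has_bits (W : nat) (x : int) : bool := (`|x| < 2 ^ W)%N.

Fixpoint expr_bits (W : nat) (st : state) (e : expr) : bool :=
  has_bits W (eval st e) &&
  match e with
  | Const _ | Var _ => true
  | Get _ e1 | Sqrt e1 => expr_bits W st e1
  | Bin _ e1 e2 => expr_bits W st e1 && expr_bits W st e2
  end.

Inductive cmd :=
  | Skip
  | Assign of nat & expr
  | Store of nat & expr & expr
  | Seq of cmd & cmd
  | If of expr & cmd & cmd
  | While of expr & cmd.

Definition set_var (st : state) (x : nat) (v : int) : state :=
  State (fun z => if z == x then v else vars st z) (arrs st).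

Definition set_arr (st : state) (b : nat) (i v : int) : state :=
  State (vars st)
    (fun c j => if (c == b) && (j == i) then v else arrs st c j).

(** [exec W c st t st']: started in [st], the command [c] halts in [st'] after
    [t] units of time, all numbers having at most [W] bits.  A test succeeds
    when its value is non-zero. *)
Inductive exec (W : nat) : cmd -> state -> nat -> state -> Prop :=
  | exec_skip st : exec W Skip st 1 st
  | exec_assign st x e :
      expr_bits W st e ->
      exec W (Assign x e) st (expr_cost e).+1 (set_var st x (eval st e))
  | exec_store st b i e :
      expr_bits W st i -> expr_bits W st e ->
      exec W (Store b i e) st (expr_cost i + expr_cost e).+1
        (set_arr st b (eval st i) (eval st e))
  | exec_seq st1 st2 st3 c1 c2 t1 t2 :
      exec W c1 st1 t1 st2 -> exec W c2 st2 t2 st3 ->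
      exec W (Seq c1 c2) st1 (t1 + t2) st3
  | exec_if st st' e c1 c2 t :
      expr_bits W st e ->
      exec W (if eval st e != 0 then c1 else c2) st t st' ->
      exec W (If e c1 c2) st (expr_cost e + t).+1 st'
  | exec_while_stop st e c :
      expr_bits W st e -> eval st e = 0 ->
      exec W (While e c) st (expr_cost e).+1 st
  | exec_while_step st1 st2 st3 e c t1 t2 :
      expr_bits W st1 e -> eval st1 e != 0 ->
      exec W c st1 t1 st2 -> exec W (While e c) st2 t2 st3 ->
      exec W (While e c) st1 (expr_cost e + t1 + t2).+1 st3.

(** Elements of ['F_p] are stored as their representatives in [[0, p)].  The
    program finds the side [m] of the array in variable 0, [p] in variable 1,
    and the entries [a x y], row by row, in array 0; all other memory is 0.  The
    double sum has at most one term. *)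
Definition input_state (p m : nat) (a : 'M['F_p]_m) : state :=
  State
    (fun z => if z == 0%N then m%:Z else if z == 1%N then p%:Z else 0)
    (fun b i =>
       if b == 0%N then
         \sum_(x < m) \sum_(y < m | i == (x * m + y)%N%:Z)
            (a x y : nat)%:Z
       else 0).

Definition output_seq (k : nat) (st : state) : seq int :=
  [seq arrs st 1 (j : nat)%:Z | j <- iota 0 k].

(** Bivariate polynomials follow [polyXY]: in [{poly {poly R}}] the variable X
    is the outer one, Y the inner one, and [f.[x, y]] substitutes (x, y). *)
Definition interpolates (p m : nat) (a : 'M['F_p]_m)
    (f : {poly {poly 'F_p}}) : Prop :=
  [/\ (size f <= m)%N, (sizeY f <= m)%N &
      forall x y : 'I_m, f.[x%:R, y%:R] = a x y].

Definition honest_poly (p m : nat) (f : {poly {poly 'F_p}}) : {poly 'F_p} :=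
  \sum_(y < m) map_poly (horner_eval (y%:R : 'F_p)) f ^+ 2.

Definition honest_message (p m : nat) (f : {poly {poly 'F_p}}) : seq int :=
  [seq ((honest_poly m f).[j%:R] : nat)%:Z | j <- iota 0 (2 * m)].

Lemma size_honest_poly (p m : nat) (f : {poly {poly 'F_p}}) :
  (size f <= m)%N -> (size (honest_poly m f) <= (2 * m.-1).+1)%N.
Proof.
move=> szf; apply: (leq_trans (size_sum _ _ _)); apply/bigmax_leqP => y _.
rewrite expr2; apply: (leq_trans (size_polyMleq _ _)).
have: (size (map_poly (horner_eval (y%:R : 'F_p)) f) <= m)%N.
  by apply: leq_trans szf; exact: size_poly.
move: (size _) => k; case: m y {szf} => [[] //|m] _ km.
by rewrite mul2n -addnn -subn1 leq_subLR add1n -addnS -addSn leq_add.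
Qed.

Lemma natr_ord_Fp_eq (p m : nat) (x y : 'I_m) :
  prime p -> (m <= p)%N -> (x%:R == y%:R :> 'F_p) = (x == y).
Proof.
move=> p_pr le_mp; apply/eqP/eqP => [|-> //] /(congr1 (@nat_of_ord _)).
by rewrite !val_Fp_nat // !modn_small ?(leq_trans (ltn_ord _)) // => /val_inj.
Qed.

Lemma poly_eq0_on_ord (p m : nat) (R : idomainType)
    (i : {rmorphism 'F_p -> R}) (q : {poly R}) :
  prime p -> (m <= p)%N -> (size q <= m)%N ->
  (forall x : 'I_m, q.[i x%:R] = 0) -> q = 0.
Proof.
move=> p_pr le_mp szq q0; pose rs := [seq i x%:R | x : 'I_m].
apply: (@roots_geq_poly_eq0 _ q rs); last by rewrite size_map -cardE card_ord.
  by apply/allP => _ /mapP[x _ ->]; apply/rootP.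
rewrite map_inj_uniq ?enum_uniq // => x y /fmorph_inj /eqP.
by rewrite natr_ord_Fp_eq // => /eqP.
Qed.

Definition lagrange_basis (p m : nat) (x : 'I_m) : {poly 'F_p} :=
  \prod_(z < m | z != x) ((x%:R - z%:R)^-1 *: ('X - z%:R%:P)).

Lemma lagrange_basisE (p m : nat) (x y : 'I_m) :
  prime p -> (m <= p)%N -> (lagrange_basis p x).[y%:R] = (x == y)%:R.
Proof.
move=> p_pr le_mp; rewrite horner_prod; have [<-|xy] := eqVneq x y.
  rewrite big1 // => z zx; rewrite !hornerE mulVf // subr_eq0.
  by rewrite natr_ord_Fp_eq // eq_sym.
by rewrite (bigD1 y) 1?eq_sym //= !hornerE subrr mulr0 mul0r.
Qed.

Lemma size_lagrange_basis (p m : nat) (x : 'I_m) :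
  (size (lagrange_basis p x) <= m)%N.
Proof.
have m_gt0 : (0 < m)%N by case: m x => [[]|].
have cE : #|[pred z : 'I_m | z != x]| = m.-1 by rewrite (cardC1 x) card_ord.
apply: leq_trans (size_poly_prod_leq _ _) _; rewrite leq_subLR.
rewrite (@leq_ltn_trans (\sum_(z < m | z != x) 2)) //.
  apply: leq_sum => z _; apply: leq_trans (size_scale_leq _ _) _.
  by rewrite size_XsubC.
by rewrite sum_nat_const cE muln2 -addnn -[X in (_ < _ + X)%N](prednK m_gt0)
           addnS.
Qed.

(** The hypothesis of the theorem on the interpolating polynomial is satisfied
    as soon as 0, ..., m - 1 are distinct in ['F_p]. *)
Lemma interpolates_unique (p m : nat) (a : 'M['F_p]_m) :
  prime p -> (m <= p)%N -> exists f, unique (interpolates a) f.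
Proof.
move=> p_pr le_mp; pose ell := @lagrange_basis p m.
pose f := \sum_x \sum_y (ell x)^:P * (a x y *: ell y)%:P.
have fP : interpolates a f.
  split.
  - apply: leq_trans (size_sum _ _ _) _; apply/bigmax_leqP => x _.
    apply: leq_trans (size_sum _ _ _) _; apply/bigmax_leqP => y _.
    rewrite mulrC mul_polyC; apply: leq_trans (size_scale_leq _ _) _.
    by rewrite size_map_polyC size_lagrange_basis.
  - rewrite sizeYE /f raddf_sum; apply: leq_trans (size_sum _ _ _) _.
    apply/bigmax_leqP => x _; rewrite raddf_sum.
    apply: leq_trans (size_sum _ _ _) _; apply/bigmax_leqP => y _ /=.
    rewrite rmorphM /= swapXY_map_polyC swapXY_polyC mul_polyC.
    apply: leq_trans (size_scale_leq _ _) _; rewrite size_map_polyC.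
    exact: leq_trans (size_scale_leq _ _) (size_lagrange_basis _ _).
  - have tE x y (x0 y0 : 'I_m) :
        ((ell x)^:P * (a x y *: ell y)%:P).[x0%:R, y0%:R] =
        (x == x0)%:R * (a x y * (y == y0)%:R).
      by rewrite hornerM hornerC hornerM horner_map /= hornerC hornerZ
                 !lagrange_basisE.
    move=> x y; rewrite /f !horner_sum (bigD1 x) //= [X in _ + X]big1.
      rewrite addr0 !horner_sum (bigD1 y) //= [X in _ + X]big1.
        by rewrite addr0 tE !eqxx mul1r mulr1.
      by move=> z zy; rewrite tE (negPf zy) !mulr0.
    move=> z zx; rewrite !horner_sum big1 // => t _.
    by rewrite tE (negPf zx) mul0r.
exists f; split=> // g [szg sYg gE].
have [szf sYf fE] := fP.
apply/eqP; rewrite -subr_eq0; apply/eqP.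
apply: (poly_eq0_on_ord (i := polyC) p_pr le_mp).
  by apply: leq_trans (size_polyD _ _) _; rewrite size_polyN geq_max szf.
move=> x; apply: (poly_eq0_on_ord (i := idfun) p_pr le_mp).
  apply: leq_trans (max_size_evalC _ _) _; rewrite sizeYE raddfB.
  apply: leq_trans (size_polyD _ _) _.
  by rewrite size_polyN geq_max -!sizeYE sYf.
by move=> y; rewrite /= !hornerD !hornerN fE gE subrr.
Qed.

(* Main.v *)
Require Import Defs.
From mathcomp Require Import all_boot all_order all_algebra.
From mathcomp Require Import finfield complex realalg.
From mathcomp Require Import ring lra zify.

Set Implicit Arguments.
Unset Strict Implicit.
Unset Printing Implicit Defensive.

Import Order.TTheory GRing.Theory Num.Theory.
Local Open Scope ring_scope.

(** Uniqueness of the interpolant forces [m <= p].  For [m <= j < p] Lagrange's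
    formula reads
      [f(j,y) = j!/(j-m)! * sum_x a(x,y)/x! * (-1)^(m-1-x)/(m-1-x)! * 1/(j-x)],
    so for each [y] the values are extended from [m] to [2m] points by one
    convolution with the kernel [1/d].  The inverses of [1, ..., 2m-1] modulo
    [p] cost one operation each, since [1/t = - (p / t) * 1/(p mod t)]; values
    at [j >= p] repeat.

    A convolution is computed over the integers by a fast Fourier transform of
    length [N = 2^k >= 3m], in fixed point with denominator [S = (N p)^13].
    The twiddle factors [w] only need [w(b)^2 = (-1)^b w(b / 2)]; they are
    products of the [2^h]-th roots of unity obtained from half-angle formulas
    and integer square roots.  Errors are multiplied by a constant at each of
    the [k] levels, hence stay polynomial in [N] and [p], far below [S], and
    the convolution is recovered by rounding.

    The program is a sequence of loops, each filling two arrays left to right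
    from the cells already written. *)

(** * Loops within a memory bound *)

(** The number of operations must not depend on [p]. This rules out one run of Euclid's algorithm
    per inverse, and also a transform inside ['F_p], which need not contain roots of unity of large
    2-power order; hence the recursive table of inverses and the detour through complex numbers. The
    exact roots live in [R[i]] over a real closed field [R], and each array cell is compared with
    such an exact value. Representatives in [[0, p)] make the convolution an integer of size at most
    [N p^2], so that rounding recovers it exactly. Length [3m] holds a row of length [m] and a
    kernel of length [2m] without wrap-around. There are [m + 1] forward and [m] backward
    transforms, each of O(m log m) operations, which gives O(n log n). The exponent 13 comes from
    the error budget: twiddle factors are off by at most [2 N^3] units, the leaves of forward
    transforms by [6 p N^7], their products by [20 p^2 N^9], and the backward levels multiply this
    by at most [N^3]. So [S] has to dominate [20 p^2 N^12]. *)

(** If all memory cells are bounded by [B], the value of [e] is bounded by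
    [B ^ vdeg e]. *)
Fixpoint vdeg (e : expr) : nat :=
  match e with
  | Const _ | Var _ | Get _ _ | Bin Le _ _ | Bin Eq _ _ => 1
  | Sqrt e1 => vdeg e1
  | Bin Mul e1 e2 => vdeg e1 + vdeg e2
  | Bin Add e1 e2 | Bin Defs.Sub e1 e2 => (maxn (vdeg e1) (vdeg e2)).+1
  | Bin _ e1 e2 => maxn (vdeg e1) (vdeg e2)
  end.

(** The degree is tested at every subexpression because intermediate results must be short too.
    Constants below 16 count as degree 1 since memory bounds are taken to be at least 16. *)
Fixpoint tame (D : nat) (e : expr) : bool :=
  (vdeg e <= D)%N &&
  match e with
  | Const c => (`|c| < 16)%N
  | Var _ => true
  | Get _ e1 | Sqrt e1 => tame D e1
  | Bin _ e1 e2 => tame D e1 && tame D e2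
  end.

Definition bounded (B : nat) (st : state) : Prop :=
  (forall z, (`|vars st z| <= B)%N) /\ (forall b i, (`|arrs st b i| <= B)%N).

Lemma isqrtP (x : int) : 0 <= x ->
  exists2 r : nat, isqrt x = r%:Z & (r ^ 2)%:Z <= x < (r.+1 ^ 2)%:Z.
Proof.
case: x => // n _; rewrite /isqrt;
  exists (\max_(i < n.+1 | (i ^ 2 <= n)%N) i)%N => //.
have r0 : ((ord0 : 'I_n.+1) ^ 2 <= n)%N by [].
rewrite (@bigop.bigmax_eq_arg _ ord0 (fun i : 'I_n.+1 => (i ^ 2 <= n)%N) _ r0).
case: arg_maxnP => // i hi mx; rewrite lez_nat hi ltz_nat /= ltnNge.
apply/negP => lt; have lti : (i.+1 < n.+1)%N.
  by rewrite ltnS (leq_trans _ lt) // leq_pmulr.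
by have := mx (Ordinal lti) lt; rewrite /= ltnn.
Qed.

Lemma isqrt_le (x : int) : (`|isqrt x| <= `|x|)%N.
Proof.
case: x => [n|n]; last by [].
have [r -> /andP[+ _]] := @isqrtP n%:Z isT; rewrite lez_nat /=; nia.
Qed.

Lemma absz_divz_le (x y : int) : (`|(x %/ y)%Z| <= `|x|)%N.
Proof.
have [->|y0] := eqVneq y 0; first by rewrite divz0.
have e := divz_eq x y; have := modz_ge0 x y0; have := ltz_mod x y0.
move: (_ %/ _)%Z (_ %% _)%Z e => q r ->; nia.
Qed.

(** The maximum accounts for the convention [x mod 0 = x]. *)
Lemma absz_modz_le (x y : int) : (`|(x %% y)%Z| <= maxn `|x| `|y|)%N.
Proof.
have [->|y0] := eqVneq y 0; first by rewrite modz0 leq_maxl.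
have := modz_ge0 x y0; have := ltz_mod x y0; lia.
Qed.

Section Bits.
Variables (B D W : nat) (st : state).
Hypotheses (B16 : (16 <= B)%N) (BDW : (B ^ D < 2 ^ W)%N) (bst : bounded B st).

(** Addition raises the degree by one because [2 B^d <= B^(d+1)]; quotients, remainders and roots do
    not outgrow their arguments. *)
Lemma eval_bound e : tame D e -> (`|eval st e| <= B ^ vdeg e)%N.
Proof.
have BX d : (0 < d -> B <= B ^ d)%N by case: d => // d _;
  rewrite expnS leq_pmulr // expn_gt0; lia.
have Bmax x y : (B ^ maxn x y = maxn (B ^ x) (B ^ y))%N.
  have B1 : (1 < B)%N by lia.
  by have [h|/ltnW h] := leqP x y;
    [apply/esym/maxn_idPr | apply/esym/maxn_idPl]; rewrite leq_exp2l.
have one d (x : int) : (`|x| <= 1 -> `|x| <= B ^ d)%N.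
  by move=> /leq_trans-> //; rewrite expn_gt0; lia.
elim: e => /= [c|z|b e _|e IH|o e1 IH1 e2 IH2].
- by move=> /andP[_ ?]; rewrite expn1; lia.
- by rewrite expn1 bst.1.
- by rewrite expn1 bst.2.
- by move=> /andP[_ /IH]; apply: leq_trans; exact: isqrt_le.
- move=> /and3P[_ /IH1{}IH1 /IH2{}IH2].
  case: o => /=.
  + rewrite expnS Bmax; nia.
  + rewrite expnS Bmax; nia.
  + by rewrite abszM expnD leq_mul.
  + by rewrite Bmax (leq_trans (absz_divz_le _ _)) // leq_max IH1.
  + by rewrite Bmax (leq_trans (absz_modz_le _ _)) // geq_max !leq_max IH1 IH2 orbT.
  + by apply: one; case: ifP.
  + by apply: one; case: ifP.
Qed.

Lemma tame_bits e : tame D e -> expr_bits W st e.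
Proof.
have bits e' : tame D e' -> has_bits W (eval st e').
  move=> te; rewrite /has_bits (leq_ltn_trans (eval_bound te)) //.
  apply: leq_ltn_trans BDW; rewrite leq_exp2l; last lia.
  by case: e' te => [?|?|? ?|?|? ? ?] /andP[].
elim: e => [c|z|b e IH|e IH|o e1 IH1 e2 IH2] te;
  rewrite /= (bits _ te) //=; move: te => /= /andP[_ te].
- exact: IH.
- exact: IH.
- by move: te => /andP[/IH1-> /IH2->].
Qed.

End Bits.

Fixpoint no_var (x : nat) (e : expr) : bool :=
  match e with
  | Const _ => true
  | Var y => y != x
  | Get _ e1 | Sqrt e1 => no_var x e1
  | Bin _ e1 e2 => no_var x e1 && no_var x e2
  end.

Lemma eval_set_var st x v e : no_var x e -> eval (set_var st x v) e = eval st e.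
Proof.
elim: e => //= [y /negPf->|b e IH /IH->|e IH /IH->|o e1 IH1 e2 IH2] //.
by move=> /andP[/IH1-> /IH2->].
Qed.

Lemma bounded_set_var B st x v :
  bounded B st -> (`|v| <= B)%N -> bounded B (set_var st x v).
Proof. by move=> [bv ba] bx; split=> //= z; case: ifP. Qed.

Lemma bounded_set_arr B st b i v :
  bounded B st -> (`|v| <= B)%N -> bounded B (set_arr st b i v).
Proof. by move=> [bv ba] bx; split=> //= c j; case: ifP. Qed.

(** All loop invariants have this shape. [fspec] relates the two arrays cell by cell, since they
    often hold the real and imaginary parts of one number. *)
Record fact := Fact {
  fa : nat; fb : nat; flen : nat; fspec : nat -> int -> int -> Prop }.

Definition holds (A : nat -> int -> int) (F : fact) : Prop :=
  forall t : nat, (t < flen F)%N -> fspec F t (A (fa F) t%:Z) (A (fb F) t%:Z).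

Fixpoint holds_all (A : nat -> int -> int) (L : seq fact) : Prop :=
  if L is F :: L' then holds A F /\ holds_all A L' else True.

Definition fresh (b : nat) (L : seq fact) : bool :=
  all (fun F => (fa F != b) && (fb F != b)) L.

Lemma holds_all_frame A A' b1 b2 L :
  (forall c j, c != b1 -> c != b2 -> A' c j = A c j) ->
  fresh b1 L -> fresh b2 L -> holds_all A L -> holds_all A' L.
Proof.
move=> AA'; elim: L => //= F L IH /andP[/andP[Fa1 Fb1] L1].
move=> /andP[/andP[Fa2 Fb2] L2] [hF hL]; split; last exact: IH.
by move=> t tF; rewrite !AA' //; apply: hF.
Qed.

(** Every loop fills two arrays left to right; [e1] is parked in variable 3 so
    that both values are computed from the same memory.  Variable 2 is the
    loop counter. *)
Definition phase_body (b1 b2 : nat) (e1 e2 : expr) : cmd :=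
  Seq (Assign 3 e1)
    (Seq (Store b2 (Var 2) e2)
       (Seq (Store b1 (Var 2) (Var 3)) (Assign 2 (Bin Add (Var 2) (Const 1))))).

Definition phase_guard (bd : expr) : expr :=
  Bin Le (Bin Add (Var 2) (Const 1)) bd.

Definition phase (b1 b2 : nat) (bd e1 e2 : expr) : cmd :=
  Seq (Assign 2 (Const 0)) (While (phase_guard bd) (phase_body b1 b2 e1 e2)).

Definition phase_cost (bd e1 e2 : expr) : nat :=
  (expr_cost bd + expr_cost e1 + expr_cost e2 + 20)%N.

Section Phase.
Variables (B D W m p : nat).
Hypotheses (B16 : (16 <= B)%N) (BDW : (B ^ D < 2 ^ W)%N).

Definition knows (L : seq fact) (st : state) : Prop :=
  [/\ vars st 0 = m%:Z, vars st 1 = p%:Z, bounded B st & holds_all (arrs st) L].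

(** A loop is verified by strong induction on its cells: a step may assume the specification of all
    earlier cells of the same arrays. The specification itself bounds what is written, which keeps
    the memory within [B]. The first hypothesis gathers all syntactic conditions, so that
    computation can discharge them. *)
Lemma phase_exec (L : seq fact) (F : fact) (bd e1 e2 : expr) (st : state) :
  [&& (2 < D)%N, fa F != fb F, fresh (fa F) L, fresh (fb F) L, no_var 3 e1,
      tame D bd, tame D e1, tame D e2 & tame D (phase_guard bd)] ->
  (flen F < B)%N ->
  (forall st, knows L st -> eval st bd = (flen F)%:Z) ->
  (forall t v1 v2, (t < flen F)%N -> fspec F t v1 v2 ->
     (`|v1| <= B)%N /\ (`|v2| <= B)%N) ->
  (forall (t : nat) st, (t < flen F)%N -> knows L st -> vars st 2 = t%:Z ->
     holds (arrs st) (Fact (fa F) (fb F) t (fspec F)) ->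
     fspec F t (eval st e1) (eval st e2)) ->
  knows L st ->
  exists t st', [/\ exec W (phase (fa F) (fb F) bd e1 e2) st t st',
    (t <= phase_cost bd e1 e2 * (flen F).+1)%N & knows (F :: L) st'].
Proof.
case/and5P=> D2 ab fra frb /and5P[nv tbd te1 te2 tg] lenB bdE specB step kst.
have kset x v st0 : (1 < x)%N -> (`|v| <= B)%N -> knows L st0 ->
    knows L (set_var st0 x v).
  by case: x => [|[|x]] // _ vB [k0 k1 k2 k3]; split=> //; exact: bounded_set_var.
suff loop d t st0 : (t + d = flen F)%N -> knows L st0 -> vars st0 2 = t%:Z ->
    holds (arrs st0) (Fact (fa F) (fb F) t (fspec F)) ->
    exists tt st', [/\ exec W (While (phase_guard bd)
                           (phase_body (fa F) (fb F) e1 e2)) st0 tt st',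
      (tt <= phase_cost bd e1 e2 * d + expr_cost bd + 6)%N &
      knows (F :: L) st'].
  have [] := loop (flen F) 0%N (set_var st 2 0) _ _ _ _ => //.
    exact: kset.
  move=> tt [st' [ex le kn]]; exists (2 + tt)%N, st'; split=> //.
    by apply: exec_seq ex; apply: exec_assign; apply: (tame_bits B16 BDW);
      [case: kst|rewrite /=; lia].
  by apply: leq_trans (_ : 2 + (phase_cost bd e1 e2 * flen F + expr_cost bd + 6)
    <= _)%N; [lia|rewrite mulnS /phase_cost; lia].
elim: d t st0 => [|d IH] t st0 tF k0 v2 hF.
  rewrite addn0 in tF; exists (expr_cost (phase_guard bd)).+1, st0; split.
  - apply: exec_while_stop; first by apply: (tame_bits B16 BDW) tg; case: k0.
    by rewrite /= v2 bdE // -tF; case: ifP => //; lia.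
  - by rewrite /phase_guard /=; lia.
  - case: k0 => ? ? ? ?; split=> //; split=> //.
    by move: hF; rewrite /holds /= tF.
have ltF : (t < flen F)%N by rewrite -tF; lia.
set s1 := set_var st0 3 (eval st0 e1).
have e1E : eval s1 e1 = eval st0 e1 by exact: eval_set_var.
(* [step] serves twice: here only to bound the parked value, so that the state after parking is
   bounded; then in that state, where [e2] is really evaluated. *)
have bnd0 : (`|eval st0 e1| <= B)%N by have [] := specB _ _ _ ltF (step _ _ ltF k0
  v2 hF).
have k1 : knows L s1 by exact: kset.
have sp : fspec F t (eval s1 e1) (eval s1 e2) by exact: step.
have [B1 B2] := specB _ _ _ ltF sp.
set s2 := set_arr s1 (fb F) t%:Z (eval s1 e2).
set s3 := set_arr s2 (fa F) t%:Z (eval s1 e1).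
set s4 := set_var s3 2 (t.+1)%:Z.
have b1 : bounded B s1 by case: k1.
have b2 : bounded B s2 by exact: bounded_set_arr.
have b3 : bounded B s3 by exact: bounded_set_arr.
have k4 : knows L s4.
  apply: kset => //; first by rewrite /=; lia.
  case: k1 => q0 q1 _ q3; split=> //.
  apply: holds_all_frame fra frb q3 => c j /negPf ca /negPf cb /=.
  by rewrite ca cb.
have [] := IH t.+1 s4 _ k4 _ _; first by lia.
- by [].
- move=> i /=; rewrite ltnS leq_eqVlt => /orP[/eqP->|it].
    by rewrite !eqxx /= eq_sym (negPf ab) /=.
  have ne : (i%:Z == t%:Z :> int) = false by apply/negP => /eqP[]; lia.
  by rewrite ne !andbF; apply: hF.
move=> tt [st' [ex le kn]].
exists (expr_cost (phase_guard bd) + ((expr_cost e1).+1 + ((1 + expr_cost e2).+1 +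
  (3 + 4))) + tt).+1, st'; split=> //; last by rewrite mulnS /phase_cost /=;
    move: le; rewrite /phase_cost; lia.
have tv z : tame D (Var z) by rewrite /= andbT; lia.
apply: exec_while_step ex.
- by apply: (tame_bits B16 BDW) tg; case: k0.
- by rewrite /= v2 bdE // ifT //; lia.
apply: exec_seq; first by apply: exec_assign; apply: (tame_bits B16 BDW) te1;
  case: k0.
apply: exec_seq.
  have := @exec_store W s1 (fb F) (Var 2) e2 (tame_bits B16 BDW b1 (tv 2))
    (tame_bits B16 BDW b1 te2).
  by rewrite /= v2; apply.
apply: exec_seq.
  have := @exec_store W s2 (fa F) (Var 2) (Var 3) (tame_bits B16 BDW b2 (tv 2))
    (tame_bits B16 BDW b2 (tv 3)).
  by rewrite /= v2 -e1E; apply.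
have tS : tame D (Bin Add (Var 2) (Const 1)) by rewrite /=; lia.
have := exec_assign 2 (tame_bits B16 BDW b3 tS).
have tE : t%:Z + 1 = t.+1%:Z by lia.
by rewrite /= v2 tE; apply.
Qed.

End Phase.

(** * Fast Fourier transform *)

(** For [H] a power of 2 this clears the bit of weight [H]. The butterfly at [i] joins the cells
    [lower H i] and [lower H i + H]. *)
Definition lower (H i : nat) : nat := i - odd (i %/ H) * H.

Section Butterfly.
Variables (H i : nat).
Hypothesis H0 : (0 < H)%N.

(** Coordinates of an index: its block of length [2H], its half of the block, and an offset. *)
Lemma block_decomp :
  exists r, [/\ (r < H)%N, i = (i %/ (2 * H) * (2 * H) + odd (i %/ H) * H + r)%N
              & lower H i = (i %/ (2 * H) * (2 * H) + r)%N].
Proof.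
exists (i %% H)%N.
have e : i = (i %/ (2 * H) * (2 * H) + odd (i %/ H) * H + i %% H)%N.
  have h2 := divn_eq (i %/ H) 2; rewrite modn2 in h2.
  by rewrite {1}(divn_eq i H) [(2 * H)%N]mulnC divnMA; lia.
by split; rewrite ?ltn_pmod // /lower {1}e addnAC addnK.
Qed.

Lemma lower_leq : (lower H i <= i)%N. Proof. exact: leq_subr. Qed.

Lemma lower_div : (lower H i %/ (2 * H) = i %/ (2 * H))%N.
Proof. by have [r [? _ ->]] := block_decomp;
  rewrite divnMDl ?(@divn_small r) ?addn0 //; lia. Qed.

Lemma upper_div : ((lower H i + H) %/ (2 * H) = i %/ (2 * H))%N.
Proof.
by have [r [? _ ->]] := block_decomp;
  rewrite -addnA divnMDl ?(@divn_small (r + H)) ?addn0 //; lia.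
Qed.

Lemma lower_even : odd (lower H i %/ H) = false.
Proof.
have [r [? _ ->]] := block_decomp.
by rewrite mulnA divnMDl // (@divn_small r) // addn0 muln2 odd_double.
Qed.

Lemma upper_odd : odd ((lower H i + H) %/ H) = true.
Proof. by rewrite -{2}(mul1n H) addnC divnMDl // oddD lower_even. Qed.

Lemma lower_id : lower H (lower H i) = lower H i.
Proof. by rewrite {1}/lower lower_even mul0n subn0. Qed.

Lemma lower_upper : lower H (lower H i + H) = lower H i.
Proof. by rewrite {1}/lower upper_odd mul1n addnK. Qed.

Lemma upper_eq : odd (i %/ H) -> (lower H i + H = i)%N.
Proof. by have [r [? + ->]] := block_decomp; move=> + o; rewrite o; lia. Qed.

Lemma lower_eq : ~~ odd (i %/ H) -> lower H i = i.
Proof. by rewrite /lower => /negPf->; rewrite mul0n subn0. Qed.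

Lemma upper_lt n : (i < n * (2 * H) -> lower H i + H < n * (2 * H))%N.
Proof.
move=> iN; have [r [? _ ->]] := block_decomp.
have : (i %/ (2 * H) < n)%N by rewrite ltn_divLR; lia.
nia.
Qed.

End Butterfly.

(** In-place fast Fourier transform in bit-reversed order.  At level [l] the
    block number [b] of length [L = 2 ^ (k - l)] holds the remainder of the
    polynomial modulo ['X^L - node b]. *)
Section FFT.
Variables (C : comNzRingType) (k : nat) (w : nat -> C).

Fixpoint fft (c : nat -> C) (l i : nat) : C :=
  if l is l'.+1 then
    let H := (2 ^ (k - l))%N in
    fft c l' (lower H i) +
      (-1) ^+ odd (i %/ H) * (w (i %/ (2 * H)) * fft c l' (lower H i + H))
  else c i.

(** If [w b ^+ 2 = node b], then [X^(2H) - node b] factors as [(X^H - w b)(X^H + w b)], and the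
    factors belong to the blocks [2b] and [2b + 1]. Twiddle factors thus depend on the block number
    only, and one table serves all levels. *)
Definition node (b : nat) : C := (-1) ^+ odd b * w (b %/ 2).

Hypothesis w2 : forall b, (b < 2 ^ k)%N -> w b ^+ 2 = node b.

(** A polynomial and its remainder modulo [X^L - node b] agree at the roots of the modulus; stating
    the invariant through these values avoids polynomial division. *)
Lemma fft_block c l b x : (l <= k)%N -> (b < 2 ^ l)%N ->
  x ^+ (2 ^ (k - l)) = node b ->
  \sum_(j < 2 ^ (k - l)) fft c l (b * 2 ^ (k - l) + j) * x ^+ j =
  \sum_(j < 2 ^ k) c j * x ^+ j.
Proof.
elim: l b => [|l IH] b lk bl xb.
  have -> : b = 0%N by move: bl; rewrite expn0; lia.
  by rewrite subn0; apply: eq_bigr => j _; rewrite mul0n add0n.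
have eL : (2 ^ (k - l) = 2 * 2 ^ (k - l.+1))%N by rewrite -expnS; congr (_ ^ _)%N;
  lia.
set H := (2 ^ (k - l.+1))%N in eL xb *.
have H0 : (0 < H)%N by rewrite expn_gt0.
have bl' : (b %/ 2 < 2 ^ l)%N by rewrite ltn_divLR // mulnC -expnS.
(* A root [x] for block [b] is one for the parent block: [x^(2H) = node b ^+ 2 = w (b %/ 2) ^+ 2 =
   node (b %/ 2)]. *)
rewrite -(IH (b %/ 2)%N (ltnW lk) bl'); last first.
  rewrite eL mulnC exprM xb exprMn -exprM mulnC exprM sqrrN expr1n expr1n mul1r.
  by apply: w2; apply: leq_trans bl' _; rewrite leq_exp2l // ltnW.
rewrite eL mul2n -addnn big_split_ord /= -big_split /=; apply: eq_bigr => j _.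
have dH : ((b * H + j) %/ H = b)%N by rewrite divnMDl // divn_small ?addn0.
have d2H : ((b * H + j) %/ (2 * H) = b %/ 2)%N by rewrite [(2 * H)%N]mulnC divnMA
  dH.
have lo : lower H (b * H + j) = (b %/ 2 * (H + H) + j)%N.
  by rewrite /lower dH {1}(divn_eq b 2) modn2 mulnDl -mulnA mul2n -addnn addnAC
    addnK.
rewrite -/H lo dH d2H exprD xb /node !addnA [X in _ + fft c l X * _]addnAC; ring.
Qed.

Lemma fft_leaf c b : (b < 2 ^ k)%N ->
  fft c k b = \sum_(j < 2 ^ k) c j * node b ^+ j.
Proof.
move=> bk; rewrite -(@fft_block c k b) // ?subnn ?expr1 //.
by rewrite big_ord1 muln1 addn0 expr0 mulr1.
Qed.

(** Leaves are values at the nodes, and evaluation is multiplicative; the length condition keeps the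
    whole product below degree [2 ^ k]. *)
Lemma fft_conv c d m1 m2 b : (b < 2 ^ k)%N -> (m1 + m2 <= 2 ^ k)%N ->
  (forall j, (m1 <= j)%N -> c j = 0) -> (forall j, (m2 <= j)%N -> d j = 0) ->
  fft (fun j => \sum_(x < j.+1) c x * d (j - x)%N) k b = fft c k b * fft d k b.
Proof.
move=> bk mk c0 d0; rewrite !fft_leaf //; set x := node b.
pose P : {poly C} := \poly_(j < m1) c j; pose Q : {poly C} := \poly_(j < m2) d j.
have PE j : P`_j = c j by rewrite coef_poly; case: ltnP => // /c0->.
have QE j : Q`_j = d j by rewrite coef_poly; case: ltnP => // /d0->.
have sP : (size P <= m1)%N by exact: size_poly.
have sQ : (size Q <= m2)%N by exact: size_poly.
have sPQ : (size (P * Q)%R <= 2 ^ k)%N.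
  by apply: leq_trans (size_polyMleq _ _) _; lia.
have hP : P.[x] = \sum_(j < 2 ^ k) c j * x ^+ j.
  rewrite (horner_coef_wide (n := 2 ^ k)); last by lia.
  by apply: eq_bigr => j _; rewrite PE.
have hQ : Q.[x] = \sum_(j < 2 ^ k) d j * x ^+ j.
  rewrite (horner_coef_wide (n := 2 ^ k)); last by lia.
  by apply: eq_bigr => j _; rewrite QE.
rewrite -hP -hQ -hornerM (horner_coef_wide _ sPQ); apply: eq_bigr => j _.
by rewrite coefM; congr (_ * _); apply: eq_bigr => i _; rewrite PE QE.
Qed.

(** Together with [fft_twist] this undoes a butterfly without halving. The backward transform
    therefore collects a factor 2 per level, which the final rounding removes. *)
Lemma fft_double c l i (H := (2 ^ (k - l.+1))%N) :
  fft c l (lower H i) *+ 2 = fft c l.+1 (lower H i) + fft c l.+1 (lower H i + H).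
Proof.
have H0 : (0 < H)%N by rewrite expn_gt0.
rewrite /= -/H lower_id // lower_upper // lower_even // upper_odd //.
by rewrite lower_div // upper_div // expr0 expr1; ring.
Qed.

Lemma fft_twist c l i (H := (2 ^ (k - l.+1))%N) :
  w (i %/ (2 * H)) * fft c l (lower H i + H) *+ 2 =
  fft c l.+1 (lower H i) - fft c l.+1 (lower H i + H).
Proof.
have H0 : (0 < H)%N by rewrite expn_gt0.
rewrite /= -/H lower_id // lower_upper // lower_even // upper_odd //.
by rewrite lower_div // upper_div // expr0 expr1; ring.
Qed.

End FFT.

(** * Fixed-point complex arithmetic *)

Section FixedPoint.
Variable R : rcfType.
Local Notation C := R[i].
Local Notation re := (@complex.Re R).
Local Notation im := (@complex.Im R).

(** The 1-norm is submultiplicative, bounds both coordinates, and is free of square roots. *)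
Definition norm1 (z : C) : R := `|re z| + `|im z|.

Lemma norm1_ge0 z : 0 <= norm1 z. Proof. exact: addr_ge0. Qed.

Lemma norm1D x y : norm1 (x + y) <= norm1 x + norm1 y.
Proof.
case: x y => [a b] [c d]; rewrite /norm1 /=.
have := ler_normD a c; have := ler_normD b d; lra.
Qed.

Lemma norm1N x : norm1 (- x) = norm1 x.
Proof. by case: x => a b; rewrite /norm1 /= !normrN. Qed.

Lemma norm1M x y : norm1 (x * y) <= norm1 x * norm1 y.
Proof.
case: x y => [a b] [c d]; rewrite /norm1 /=.
have := ler_normB (a * c) (b * d); have := ler_normD (a * d) (b * c).
rewrite !normrM; move: `|a| `|b| `|c| `|d| => *; lra.
Qed.

Lemma norm1_real (a : R) : norm1 (Complex a 0) = `|a|.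
Proof. by rewrite /norm1 /= normr0 addr0. Qed.

Lemma norm1_nat n : norm1 n%:R = n%:R.
Proof.
have -> : (n%:R : C) = Complex n%:R 0 by rewrite -(rmorph_nat (real_complex R)).
by rewrite norm1_real normr_nat.
Qed.

Lemma norm1_sign (b : bool) x : norm1 ((-1) ^+ b * x) = norm1 x.
Proof. by case: b; rewrite ?expr0 ?mul1r // expr1 mulN1r norm1N. Qed.

Definition gauss (a b : int) : C := Complex a%:~R b%:~R.

Lemma gaussD a b c d : gauss (a + c) (b + d) = gauss a b + gauss c d.
Proof. by rewrite /gauss !intrD. Qed.

Lemma gaussN a b : gauss (- a) (- b) = - gauss a b.
Proof. by rewrite /gauss !mulrNz. Qed.

Variable S : int.
Hypothesis S0 : 0 < S.
Local Notation s := (S%:~R : R).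

Let s0 : 0 < s. Proof. by rewrite ltr0z. Qed.

(** [(a + b i) / S] approximates [x] to within [e / S]. *)
Definition close (e : R) (a b : int) (x : C) : Prop :=
  norm1 (gauss a b - Complex s 0 * x) <= e.

Lemma close_weak e e' a b x : close e a b x -> e <= e' -> close e' a b x.
Proof. exact: le_trans. Qed.

Lemma close_eq a b x : gauss a b = Complex s 0 * x -> close 0 a b x.
Proof. by rewrite /close => ->; rewrite subrr norm1_real normr0. Qed.

Lemma closeD e1 e2 a b c d x y : close e1 a b x -> close e2 c d y ->
  close (e1 + e2) (a + c) (b + d) (x + y).
Proof.
move=> h1 h2; rewrite /close gaussD mulrDr opprD addrACA.
exact: le_trans (norm1D _ _) (lerD h1 h2).
Qed.

Lemma closeN e a b x : close e a b x -> close e (- a) (- b) (- x).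
Proof. by rewrite /close gaussN mulrN -opprD norm1N. Qed.

Lemma closeB e1 e2 a b c d x y : close e1 a b x -> close e2 c d y ->
  close (e1 + e2) (a - c) (b - d) (x - y).
Proof. by move=> h1 /closeN; exact: closeD. Qed.

Lemma close_conj e a b x :
  close e a b x -> close e a (- b) (Complex (re x) (- im x)).
Proof.
case: x => c d; rewrite /close /norm1 /=; apply: le_trans.
rewrite mulrNz (_ : s * c - 0 * - d = s * c - 0 * d); last by ring.
by rewrite (_ : - b%:~R - (s * - d + 0 * c) = - (b%:~R - (s * d + 0 * c)));
  [rewrite normrN | ring].
Qed.

Lemma close_norm e a b x : close e a b x -> norm1 (gauss a b) <= s * norm1 x + e.
Proof.
move=> h; rewrite -[gauss a b](subrK (Complex s 0 * x)).
have := norm1D (gauss a b - Complex s 0 * x) (Complex s 0 * x).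
have := norm1M (Complex s 0) x; rewrite norm1_real gtr0_norm //; move: h;
  rewrite /close; lra.
Qed.

Lemma floor_error (n d : int) : 0 < d ->
  `|((n %/ d)%Z)%:~R - n%:~R / d%:~R| <= (1 : R).
Proof.
move=> d0; have d0' : (0 : R) < d%:~R by rewrite ltr0z.
have e := divz_eq n d; have r0 := modz_ge0 n (lt0r_neq0 d0);
  have r1 := ltz_pmod n d0.
move: (_ %/ _)%Z (_ %% _)%Z e r0 r1 => q r -> r0 r1.
rewrite intrD intrM mulrDl mulfK ?gt_eqF // opprD addrA subrr sub0r normrN.
rewrite normrM normfV (gtr0_norm d0') ler_pdivrMr // mul1r ger0_norm ?ler0z //.
by rewrite ler_int ltW.
Qed.

(** The three terms are the two floors, the error of the first factor times the approximate second
    one (of norm at most [Y + 1], as [e2 <= s]), and the exact first factor times the error of the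
    second. *)
Lemma closeM e1 e2 X Y a b c d x y :
  close e1 a b x -> close e2 c d y -> norm1 x <= X -> norm1 y <= Y -> e2 <= s ->
  close (2 + e1 * (Y + 1) + X * e2)
    ((a * c - b * d) %/ S)%Z ((a * d + b * c) %/ S)%Z (x * y).
Proof.
move=> h1 h2 hX hY e2s; rewrite /close.
set g := gauss _ _; set g1 := gauss a b in h1 *; set g2 := gauss c d in h2 *.
pose t := Complex s^-1 0 * g2.
have sV : Complex s 0 * Complex s^-1 0 = 1 :> C.
  by rewrite -[LHS](rmorphM (real_complex R)) mulfV ?gt_eqF // rmorph1.
have -> : g - Complex s 0 * (x * y) =
    (g - g1 * t) + ((g1 - Complex s 0 * x) * t + x * (g2 - Complex s 0 * y)).
  have -> : x * (g2 - Complex s 0 * y) = x * (Complex s 0 * Complex s^-1 0) * g2 -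
    Complex s 0 * (x * y) by rewrite sV; ring.
  by rewrite /t; ring.
have hg : norm1 (g - g1 * t) <= 2.
  have := floor_error (a * c - b * d) S0; have := floor_error (a * d + b * c) S0.
  rewrite /g /g1 /t /g2 /gauss /norm1 /= !(intrD, mulrNz, intrM).
  rewrite (_ : a%:~R * (s^-1 * c%:~R - 0 * d%:~R) - b%:~R * (s^-1 * d%:~R + 0 *
    c%:~R) =
    (a%:~R * c%:~R - b%:~R * d%:~R) / s); last by ring.
  rewrite (_ : a%:~R * (s^-1 * d%:~R + 0 * c%:~R) + b%:~R * (s^-1 * c%:~R - 0 *
    d%:~R) =
    (a%:~R * d%:~R + b%:~R * c%:~R) / s); last by ring.
  lra.
have e20 : 0 <= e2 by apply: le_trans h2; exact: norm1_ge0.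
have e10 : 0 <= e1 by apply: le_trans h1; exact: norm1_ge0.
have ht : norm1 t <= Y + 1.
  apply: le_trans (norm1M _ _) _; rewrite norm1_real gtr0_norm ?invr_gt0 //.
  rewrite mulrC ler_pdivrMr //; apply: le_trans (close_norm h2) _.
  have : s * norm1 y <= s * Y by rewrite ler_pM2l.
  lra.
apply: le_trans (norm1D _ _) _; rewrite -[leRHS]addrA; apply: lerD => //.
apply: le_trans (norm1D _ _) _; apply: lerD; apply: le_trans (norm1M _ _) _;
  by apply: ler_pM => //; exact: norm1_ge0.
Qed.

Lemma close_gauss a : close 0 (a * S) 0 a%:~R.
Proof.
apply: close_eq.
rewrite -(rmorph_int (real_complex R)) /gauss intrM /=.
by apply/eqP; rewrite eq_complex /=; apply/andP; split; apply/eqP; ring.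
Qed.

Lemma close_bound e a b x (M : nat) :
  close e a b x -> s * norm1 x + e <= M%:R -> (`|a| <= M)%N /\ (`|b| <= M)%N.
Proof.
move=> /close_norm h1 h2; have := le_trans h1 h2; rewrite /norm1 /=.
rewrite -!intr_norm -intrD -[M%:R]/((M%:Z)%:~R) ler_int; lia.
Qed.

(** With [q = S n], the floor of [(2a + q) / (2q)] is the integer nearest to [a / q]. *)
Lemma close_round e a b (c : int) (n : nat) :
  close e a b (n%:R * c%:~R) -> (0 < n)%N -> 2 * e < s * n%:R ->
  ((2 * a + S * n%:Z) %/ (2 * (S * n%:Z)))%Z = c.
Proof.
move=> h n0 en.
have hR : `|a%:~R - s * n%:R * c%:~R| <= e.
  apply: le_trans h; rewrite -(rmorph_nat (real_complex R)) -(rmorph_int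
    (real_complex R)).
  rewrite /norm1 /= (_ : s * (n%:R * c%:~R - 0 * 0) - 0 * (n%:R * 0 + 0 * c%:~R) =
    s * n%:R * c%:~R); last by ring.
  by rewrite lerDl.
have {hR} : `|a - S * n%:Z * c| *+ 2 < S * n%:Z.
  rewrite -(ltr_int R) mulr2n !intrD !intr_norm !intrD mulrNz !intrM.
  by rewrite -[(n%:Z)%:~R]/(n%:R); lra.
move=> h2; apply/eqP; rewrite eq_le; have d0 : 0 < 2 * (S * n%:Z) by nia.
rewrite lez_divRL // -ltzD1 ltz_divLR //; move: (S * n%:Z) d0 h2 => q; nia.
Qed.

End FixedPoint.

(** * Roots of unity by half-angle formulas *)

Section Twiddles.
Variable R : rcfType.
Local Notation C := R[i].

(** Cosine and sine of [pi / 2 ^ h.+1], by the half-angle formulas. *)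
Fixpoint cos_sin (h : nat) : R * R :=
  if h is h'.+1 then
    let c := Num.sqrt ((1 + (cos_sin h').1) / 2) in (c, (cos_sin h').2 / (2 * c))
  else (0, 1).

(** The lower bound on the new cosine makes the square root and the division by [2 c'] numerically
    stable. *)
Lemma cos_sinS h (c := (cos_sin h).1) (c' := (cos_sin h.+1).1) : 0 <= c ->
  c' ^+ 2 = (1 + c) / 2 /\ 1 / 2 <= c'.
Proof.
move=> c0; rewrite /c' /= -/c; set q := (1 + c) / 2.
have q2 : 1 / 2 <= q by rewrite /q; lra.
have sq : Num.sqrt q ^+ 2 = q by rewrite sqr_sqrtr //; lra.
split=> //; have := sqrtr_ge0 q; move: (Num.sqrt q) sq => r; nra.
Qed.

Lemma cos_sinP h (c := (cos_sin h).1) (s := (cos_sin h).2) :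
  [/\ 0 <= c, c <= 1, 0 <= s, s <= 1 & c ^+ 2 + s ^+ 2 = 1].
Proof.
rewrite {}/c {}/s; elim: h => [|h [c0 c1 s0 s1 cs1]]; first by split=> //=;
  rewrite ?ler01 //; ring.
have [c2 c'2] := cos_sinS c0.
have -> : (cos_sin h.+1).2 = (cos_sin h).2 / (2 * (cos_sin h.+1).1) by [].
move: (cos_sin h.+1).1 (cos_sin h).1 (cos_sin h).2 c2 c'2 c0 c1 s0 s1 cs1.
move=> c' c0 s0 c2 c'2 c00 c01 s00 s01 cs1.
have t : s0 / (2 * c') * (2 * c') = s0 by rewrite divfK //; lra.
have t0 : 0 <= s0 / (2 * c') by rewrite divr_ge0 //; lra.
have : (s0 / (2 * c')) ^+ 2 * (4 * c' ^+ 2) = s0 ^+ 2 by rewrite -[in RHS]t; ring.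
move: (s0 / _) t t0 => s' t t0; rewrite c2 => hs.
have s2 : s' ^+ 2 = (1 - c0) / 2.
  apply: (@mulIf _ (4 * ((1 + c0) / 2))); first by lra.
  by rewrite hs; have -> : s0 ^+ 2 = 1 - c0 ^+ 2 by [lra|]; field.
by split=> //; [lra | nra | nra | lra].
Qed.

(** The root of unity of order [2 ^ (h + 2)] with angle [pi / 2 ^ (h + 1)]; in particular [rho 0] is
    the imaginary unit. *)
Definition rho (h : nat) : C := Complex (cos_sin h).1 (cos_sin h).2.

Lemma rho0_sqr : rho 0 ^+ 2 = -1.
Proof.
by apply/eqP; rewrite expr2 eq_complex /=; apply/andP; split; apply/eqP; ring.
Qed.

Lemma rhoS_sqr h : rho h.+1 ^+ 2 = rho h.
Proof.
have [c0 _ _ _ cs] := cos_sinP h; have [_ _ _ _ cs'] := cos_sinP h.+1.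
have [c2 c'2] := cos_sinS c0.
have t : (cos_sin h.+1).2 * (2 * (cos_sin h.+1).1) = (cos_sin h).2.
  by rewrite -[(cos_sin h.+1).2]/((cos_sin h).2 / (2 * (cos_sin h.+1).1)) divfK
    //; lra.
apply/eqP; rewrite expr2 eq_complex /rho;
  move: (cos_sin h.+1) t c2 c'2 cs' => [c' s'] /=.
by move=> t c2 c'2 cs'; apply/andP; split; apply/eqP; lra.
Qed.

Definition unitary (z : C) : Prop := complex.Re z ^+ 2 + complex.Im z ^+ 2 = 1.

Lemma unitaryM x y : unitary x -> unitary y -> unitary (x * y).
Proof.
case: x y => [a b] [c d]; rewrite /unitary /= => h1 h2.
rewrite (_ : _ + _ = (a ^+ 2 + b ^+ 2) * (c ^+ 2 + d ^+ 2)); last by ring.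
by rewrite h1 h2 mulr1.
Qed.

Lemma unitary_norm1 x : unitary x -> norm1 x <= 2.
Proof.
case: x => a b; rewrite /unitary /norm1 /= -(real_normK (num_real a)) -(real_normK
  (num_real b)).
move: `|a| `|b| => u v uv; have := sqr_ge0 (u - 1); have := sqr_ge0 (v - 1); lra.
Qed.

Definition conj1 (x : C) : C := Complex (complex.Re x) (- complex.Im x).

Lemma unitary_conj x : unitary x -> conj1 x * x = 1.
Proof.
case: x => a b; rewrite /unitary /conj1 /= => h; apply/eqP; rewrite eq_complex /=.
by apply/andP; split; apply/eqP; lra.
Qed.

Lemma norm1_conj x : norm1 (conj1 x) = norm1 x.
Proof. by rewrite /norm1 /= normrN. Qed.

Variable k : nat.

(** Binary digit [h] of [b] contributes the angle [pi / 2 ^ (h + 1)]: the total is [pi] times the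
    bit-reversed [b], read as a binary fraction. *)
Definition tw (b : nat) : C := \prod_(h < k) rho h ^+ odd (b %/ 2 ^ h).

Lemma tw_unitary b : unitary (tw b).
Proof.
apply: big_ind => [|x y|h _]; [by rewrite /unitary /=; ring | exact: unitaryM |].
case: odd; rewrite ?expr0 ?expr1; last by rewrite /unitary /=; ring.
by have [] := cos_sinP h.
Qed.

Lemma tw0 : tw 0 = 1.
Proof. by apply: big1 => h _; rewrite div0n. Qed.

(** Doubling the angle shifts the binary fraction: digit 0 becomes the sign, and the other digits
    are those of [b %/ 2]. *)
Lemma tw_sqr b : (b < 2 ^ k)%N -> tw b ^+ 2 = node tw b.
Proof.
rewrite /node /tw; case: k => [|n] bn.
  by have -> : b = 0%N; [move: bn; rewrite expn0;
    lia | rewrite !big_ord0 expr1n mulr1].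
rewrite -prodrXl [LHS]big_ord_recl /= [in RHS]big_ord_recr /=.
rewrite expn0 divn1 -exprM mulnC exprM rho0_sqr.
rewrite -divnMA -expnS [(b %/ 2 ^ n.+1)%N]divn_small //= expr0 mulr1; congr (_ * _).
apply: eq_bigr => h _; rewrite /bump /= -exprM mulnC exprM rhoS_sqr.
by rewrite -divnMA -expnS.
Qed.

(** Splitting off the leading bit computes a table entry by one product, at a recursion depth equal
    to the number of bits; errors grow with that depth only. *)
Lemma tw_pow2D h b : (h < k)%N -> (b < 2 ^ h)%N -> tw (2 ^ h + b) = tw b * rho h.
Proof.
move=> hk bh; rewrite /tw (bigD1 (Ordinal hk)) //= [in RHS](bigD1 (Ordinal hk)) //=.
rewrite -{1}(mul1n (2 ^ h)%N) divnMDl ?expn_gt0 // divn_small //= mul1r mulrC.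
congr (_ * _); apply: eq_bigr => -[j jk] /= /eqP ne.
have {}ne : j != h by apply/eqP => e; apply: ne; apply: val_inj.
congr (_ ^+ _); congr nat_of_bool; have [jh|hj] := ltnP j h.
  have -> : (2 ^ h = 2 ^ (h - j) * 2 ^ j)%N by rewrite -expnD; congr (_ ^ _)%N; lia.
  rewrite divnMDl ?expn_gt0 // oddD oddX /=.
  by have -> : (h - j == 0)%N = false by lia.
have lt : (2 ^ h.+1 <= 2 ^ j)%N by rewrite leq_exp2l //; lia.
by rewrite expnS in lt; rewrite !divn_small //; lia.
Qed.

(** Since [s c >= s / 2], an error [s e / 2 + 1] in the radicand becomes at most [e + 2 / s] in the
    root; then [s >= 1], and the floor costs one more. *)
Lemma sqrt_error (s e c r q : R) :
  1 <= s -> 0 <= e -> 1 / 2 <= c -> 0 <= r ->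
  s ^+ 2 * c ^+ 2 - s * e / 2 - 1 <= q -> q <= s ^+ 2 * c ^+ 2 + s * e / 2 + 1 ->
  r ^+ 2 <= q -> q < (r + 1) ^+ 2 -> `|r - s * c| <= e + 3.
Proof.
move=> s1 e0 c2 r0 q1 q2 r1 r2; have sc : s / 2 <= s * c by nra.
rewrite ler_norml; apply/andP; split.
  rewrite leNgt; apply/negP => lt.
  have : 0 <= (s * c - (r + 1) - (e + 2)) * (s * c) by apply: mulr_ge0; lra.
  have : 0 <= (s * c - (r + 1)) * (r + 1) by apply: mulr_ge0; lra.
  have : (s / 2) * (e + 2) <= s * c * (e + 2) by apply: ler_wpM2r; lra.
  nra.
rewrite leNgt; apply/negP => lt.
have : 0 <= (r - s * c - (e + 3)) * (s * c) by apply: mulr_ge0; lra.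
have : 0 <= (r - s * c) * r by apply: mulr_ge0; lra.
have : (s / 2) * (e + 3) <= s * c * (e + 3) by apply: ler_wpM2r; lra.
nra.
Qed.

(** The error is [s ((v - s sn) - 2 s' (r - s c)) / (2 r)]; the bracket is at most [3 e + 6] and
    [2 r >= s / 2]. *)
Lemma sine_error (s e c s' sn r v y : R) :
  0 < s -> s / 4 <= r -> 0 <= s' -> s' <= 1 -> s' * (2 * c) = sn ->
  `|v - s * sn| <= e -> `|r - s * c| <= e + 3 -> y * (2 * r) = v * s ->
  `|y - s * s'| <= 8 * e + 12.
Proof.
move=> s0 r4 s'0 s'1 t hv hr yE; have r0 : 0 < 2 * r by lra.
have dE : (y - s * s') * (2 * r) = s * ((v - s * sn) - 2 * s' * (r - s * c)).
  by rewrite mulrBl yE -t; ring.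
have b1 : `|(v - s * sn) - 2 * s' * (r - s * c)| <= 3 * e + 6.
  have : `|2 * s' * (r - s * c)| <= 2 * (e + 3).
    by rewrite normrM; apply: ler_pM => //; rewrite ger0_norm; lra.
  have := ler_normB (v - s * sn) (2 * s' * (r - s * c)); lra.
have e0 : 0 <= e by exact: le_trans hv.
rewrite -(ler_pM2r r0) -{1}(gtr0_norm r0) -normrM dE normrM (gtr0_norm s0).
apply: le_trans (_ : s * (3 * e + 6) <= _); first by rewrite ler_pM2l.
apply: le_trans (_ : (8 * e + 12) * (s / 2) <= _); first by nra.
by apply: ler_wpM2l; lra.
Qed.

Variable S : int.
Hypothesis S0 : 0 < S.
Local Notation s := (S%:~R : R).

(** The condition [4 e + 12 <= s] yields [r >= s / 2 - (e + 3) >= s / 4], as [sine_error] requires;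
    the last unit in [8 e + 13] is the floor of the division. *)
Lemma half_angle_error e h (u v : int) (r := isqrt ((S * S + u * S) %/ 2)%Z) :
  `|u%:~R - s * (cos_sin h).1| <= e -> `|v%:~R - s * (cos_sin h).2| <= e ->
  4 * e + 12 <= s ->
  `|r%:~R - s * (cos_sin h.+1).1| <= e + 3 /\
  `|((v * S) %/ (2 * r))%Z%:~R - s * (cos_sin h.+1).2| <= 8 * e + 13.
Proof.
move=> hu hv es.
have e0 : 0 <= e by exact: le_trans hu.
have s1 : 1 <= s by rewrite ler1z -gtz0_ge1.
have [c0 c1 sn0 sn1 _] := cos_sinP h; have [c2 c'2] := cos_sinS c0.
have [_ c'1 s'0 s'1 _] := cos_sinP h.+1.
have t : (cos_sin h.+1).2 * (2 * (cos_sin h.+1).1) = (cos_sin h).2.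
  by rewrite -[(cos_sin h.+1).2]/((cos_sin h).2 / (2 * (cos_sin h.+1).1)) divfK
    //; lra.
move: (cos_sin h.+1).1 (cos_sin h.+1).2 (cos_sin h).1 (cos_sin h).2
  t hu hv c0 c1 sn0 sn1 c2 c'2 c'1 s'0 s'1 => c' s' c sn
  t hu hv c0 c1 sn0 sn1 c2 c'2 c'1 s'0 s'1.
rewrite !ler_norml in hu hv; move: hu hv => /andP[u1 u2] /andP[v1 v2].
set q := ((S * S + u * S) %/ 2)%Z in r *.
have := @floor_error R (S * S + u * S) 2 isT; rewrite -/q intrD !intrM => hq.
rewrite ler_norml in hq; move: hq => /andP[q1 q2].
have q1' : s ^+ 2 * c' ^+ 2 - s * e / 2 - 1 <= q%:~R.
  rewrite c2; have : s * (s * c - e) <= s * u%:~R by rewrite ler_pM2l; lra.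
  move: q1; rewrite -[2%:~R]/(2 : R); lra.
have q2' : q%:~R <= s ^+ 2 * c' ^+ 2 + s * e / 2 + 1.
  rewrite c2; have : s * u%:~R <= s * (s * c + e) by rewrite ler_pM2l; lra.
  move: q2; rewrite -[2%:~R]/(2 : R); lra.
have q0 : 0 <= q.
  rewrite -(ler0z R); apply: le_trans q1'.
  have : (s * (1 / 2)) ^+ 2 <= (s * c') ^+ 2 by rewrite ler_sqr ?nnegrE; nra.
  by rewrite !exprMn; nra.
have [r' rE] := isqrtP q0; rewrite /r rE => /andP[r1 r2].
have {}r1 : r'%:R ^+ 2 <= q%:~R :> R.
  by rewrite -natrX -[(r' ^ 2)%:R]/((r' ^ 2)%:Z%:~R) ler_int.
have {}r2 : q%:~R < (r'%:R + 1) ^+ 2 :> R.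
  by rewrite natr1 -natrX -[(r'.+1 ^ 2)%:R]/((r'.+1 ^ 2)%:Z%:~R) ltr_int.
rewrite -[r'%:Z%:~R]/(r'%:R : R).
have r'0 : 0 <= r'%:R :> R by exact: ler0n.
have hr : `|r'%:R - s * c'| <= e + 3 by exact: sqrt_error q1' q2' r1 r2.
split=> //; rewrite ler_norml in hr; move: hr => /andP[hr1 hr2].
have sc : s * (1 / 2) <= s * c' by rewrite ler_pM2l ?(lt_le_trans ltr01).
have r4 : s / 4 <= r'%:R by lra.
have rpos : 0 < r'%:R :> R by lra.
have r'pos : 0 < 2 * r'%:Z by rewrite mulr_gt0 // ltz_nat -(ltr0n R).
have := floor_error R (v * S) r'pos.
rewrite !intrM -[r'%:Z%:~R]/(r'%:R : R) -[2%:~R]/(2 : R).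
set y := v%:~R * s / _ => hy.
have yE : y * (2 * r'%:R) = v%:~R * s by rewrite /y divfK //; lra.
have hy2 : `|y - s * s'| <= 8 * e + 12.
  by apply: (sine_error (lt_le_trans ltr01 s1) r4 s'0 s'1 t _ _ yE) => //;
    rewrite ler_norml; apply/andP.
apply: le_trans (ler_distD y _ _) _; rewrite addrC.
by apply: le_trans (lerD hy2 hy) _; rewrite -addrA natr1.
Qed.

End Twiddles.

(** * Extrapolation over a prime field *)

Section PrimeField.
Variable p : nat.
Hypothesis p_pr : prime p.

Lemma natr_Fp_eq0 n : (n%:R == 0 :> 'F_p) = (p %| n)%N.
Proof. by rewrite -(dvdn_pcharf (pchar_Fp p_pr)). Qed.

Lemma natr_Fp_mod n : (n %% p)%:R = n%:R :> 'F_p.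
Proof.
by apply: val_inj; rewrite /= !(@val_Fp_nat p) // modn_mod.
Qed.

Lemma natr_Fp_nz n : (0 < n < p)%N -> n%:R != 0 :> 'F_p.
Proof. by move=> /andP[n0 np]; rewrite natr_Fp_eq0 gtnNdvd. Qed.

Lemma fact_Fp_nz n : (n < p)%N -> (n`!)%:R != 0 :> 'F_p.
Proof.
elim: n => [|n IH] np; first by rewrite oner_neq0.
by rewrite factS natrM mulf_neq0 ?IH ?(ltnW np) // natr_Fp_nz.
Qed.

Lemma Fp_natK (u : 'F_p) : (u : nat)%:R = u. Proof. exact: natr_Zp. Qed.

Lemma Fp_lt (u : 'F_p) : (u < p)%N.
Proof. by have := ltn_ord u; rewrite [X in (_ < X)%N](Fp_cast p_pr). Qed.

(** If [p < m], then ['X^p - 'X] vanishes on all of ['F_p] and has size at most [m], so adding it to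
    [f] gives a second interpolant. *)
Lemma unique_interpolation_side (m : nat) (a : 'M['F_p]_m) f :
  unique (interpolates a) f -> (m <= p)%N.
Proof.
move=> [[szf sYf fE] uf]; rewrite leqNgt; apply/negP => pm.
pose d : {poly {poly 'F_p}} := 'X^p - 'X.
have p1 := prime_gt1 p_pr.
have szd : size d = p.+1 by rewrite size_polyDl size_polyXn // size_polyN
  size_polyX.
suff : f = f + d.
  move=> /eqP; rewrite -{1}(addr0 f) (inj_eq (addrI f)) => /eqP/esym d0.
  by rewrite d0 size_poly0 in szd.
apply: uf; split.
- by rewrite (leq_trans (size_polyD _ _)) // geq_max szf szd.
- rewrite sizeYE raddfD /= (leq_trans (size_polyD _ _)) // geq_max -sizeYE sYf /=.
  rewrite /d raddfB /= rmorphXn /= swapXY_X -rmorphXn /= -rmorphB /=.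
  by rewrite (leq_trans (size_polyC_leq1 _)) //; lia.
- move=> x y; rewrite hornerD [d.[_]](_ : _ = 0) ?addr0 ?fE //.
  rewrite hornerD hornerN hornerXn hornerX -rmorphXn /=.
  by have := @expf_card 'F_p x%:R; rewrite card_Fp // => ->; rewrite subrr.
Qed.

Lemma ffact_prod n j : (j <= n)%N ->
  \prod_(0 <= z < j) (n%:R - z%:R) = (n ^_ j)%:R :> 'F_p.
Proof.
elim: j => [|j IH] jn; first by rewrite big_nil ffactn0.
by rewrite big_nat_recr //= IH ?(ltnW jn) // ffactnSr natrM natrB // ltnW.
Qed.

Lemma fact_prod_neg n m : (n < m)%N ->
  \prod_(n.+1 <= z < m) (n%:R - z%:R) =
  (-1) ^+ (m.-1 - n) * ((m.-1 - n)`!)%:R :> 'F_p.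
Proof.
move=> nm; rewrite -{1}[n.+1]add0n big_addn.
have -> : (m.-1 - n = m - n.+1)%N by lia.
elim: (m - n.+1)%N => [|j IH]; first by rewrite big_nil mulr1.
rewrite big_nat_recr //= IH exprS factS natrM.
have -> : n%:R - (j + n.+1)%:R = - j.+1%:R :> 'F_p by rewrite addnS addnC -addSn
  natrD; ring.
ring.
Qed.

(** In the Lagrange basis at [k], the numerator is the falling factorial [k ^_ m] without its factor
    [k - x]; the denominator splits at [x] into [x!] and a signed [(m - 1 - x)!]. All factorials are
    invertible because [k < p]. *)
Lemma lagrange_extrapolation m k (q : {poly 'F_p}) :
  (0 < m)%N -> (size q <= m)%N -> (m <= k < p)%N ->
  q.[k%:R] = (k`!)%:R * ((k - m)`!)%:R^-1 *
    \sum_(x < m) q.[x%:R] * (x`!)%:R^-1 *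
       ((-1) ^+ (m.-1 - x) * ((m.-1 - x)`!)%:R^-1) * (k - x)%:R^-1.
Proof.
move=> m0 szq /andP[mk kp]; have mp : (m <= p)%N by exact: leq_trans (ltnW kp).
have qE : q = \sum_(x < m) q.[x%:R] *: lagrange_basis p x.
  apply/eqP; rewrite -subr_eq0; apply/eqP.
  apply: (@poly_eq0_on_ord p m _ idfun) => //.
    rewrite (leq_trans (size_polyD _ _)) // size_polyN geq_max szq /=.
    apply: leq_trans (size_sum _ _ _) _; apply/bigmax_leqP => x _.
    exact: leq_trans (size_scale_leq _ _) (size_lagrange_basis _ _).
  move=> x; rewrite /= hornerD hornerN horner_sum (bigD1 x) //= big1 ?addr0.
    by rewrite hornerZ lagrange_basisE // eqxx mulr1 subrr.
  by move=> z zx; rewrite hornerZ lagrange_basisE // (negPf zx) mulr0.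
rewrite {1}qE horner_sum mulr_sumr; apply: eq_bigr => x _.
rewrite hornerZ -!mulrA; rewrite [RHS]mulrA [RHS]mulrC -!mulrA; congr (_ * _).
rewrite horner_prod.
have xm := ltn_ord x.
have num : \prod_(z < m | z != x) (k%:R - z%:R) * (k - x)%:R = (k`!)%:R * ((k -
  m)`!)%:R^-1 :> 'F_p.
  have := ffact_prod mk; rewrite big_mkord (bigD1 x) //= mulrC natrB => [->|];
    last by lia.
  by rewrite -(ffact_fact mk) natrM mulfK // fact_Fp_nz //; lia.
have den : \prod_(z < m | z != x) (x%:R - z%:R) =
    (x`!)%:R * ((-1) ^+ (m.-1 - x) * ((m.-1 - x)`!)%:R) :> 'F_p.
  rewrite -(fact_prod_neg xm) -(ffactnn x) -(ffact_prod (leqnn x)).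
  rewrite -(big_mkord (fun z => z != x :> nat) (fun z => x%:R - z%:R)).
  rewrite (big_cat_nat (n := x)) //=; last exact: ltnW.
  congr (_ * _).
    by rewrite big_nat_cond [RHS]big_nat_cond; apply: eq_bigl => z; lia.
  rewrite big_ltn_cond // eqxx /=.
  by rewrite big_nat_cond [RHS]big_nat_cond; apply: eq_bigl => z; lia.
under eq_bigr => z _ do rewrite !hornerE.
rewrite big_split /= prodfV den.
have kx : (k - x)%:R != 0 :> 'F_p by rewrite natr_Fp_nz //; lia.
apply: (mulIf kx); rewrite -mulrA num !invfM invr_sign.
by rewrite -[LHS]mulr1 -[X in _ * X = _](mulVf kx); ring.
Qed.

Definition row_poly (f : {poly {poly 'F_p}}) (y : nat) : {poly 'F_p} :=
  map_poly (horner_eval (y%:R : 'F_p)) f.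

Lemma row_polyE f y c : (row_poly f y).[c] = f.[c, y%:R].
Proof. by rewrite -[c in LHS](hornerC c (y%:R)) [LHS]horner_map. Qed.

Lemma honest_polyE m f c :
  (honest_poly m f).[c] = \sum_(0 <= y < m) (row_poly f y).[c] ^+ 2.
Proof.
rewrite /honest_poly horner_sum big_mkord; apply: eq_bigr => y _.
by rewrite horner_exp.
Qed.

End PrimeField.

(** * The program *)

Declare Scope expr_scope.
Delimit Scope expr_scope with X.
Bind Scope expr_scope with expr.
Local Notation "x + y" := (Bin Add x y) : expr_scope.
Local Notation "x - y" := (Bin Defs.Sub x y) : expr_scope.
Local Notation "x * y" := (Bin Mul x y) : expr_scope.
Local Notation "x / y" := (Bin Div x y) : expr_scope.
Local Notation "x %% y" := (Bin Mod x y) : expr_scope.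
Local Notation "# n" := (Const (Posz n)) (at level 1, format "# n") : expr_scope.

(** Expressions do not branch, so both arms are evaluated and charged. The discarded arm may read
    meaningless cells or divide by 0; [tame] bounds its value in any bounded memory. *)
Definition xite (c x y : expr) : expr := ((c * x) + ((#1 - c) * y))%X.
Definition xlt (x y : expr) : expr := (Bin Le (x + #1) y)%X.
Definition xeq (x y : expr) : expr := (Bin Eq x y)%X.

Section Evaluation.
Variable st : state.
Implicit Types (e : expr) (n : nat).

Lemma ev_add e1 e2 n1 n2 : eval st e1 = n1%:Z -> eval st e2 = n2%:Z ->
  eval st (e1 + e2)%X = (n1 + n2)%N%:Z.
Proof. by move=> /= -> ->. Qed.

Lemma ev_sub e1 e2 n1 n2 : eval st e1 = n1%:Z -> eval st e2 = n2%:Z ->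
  (n2 <= n1)%N -> eval st (e1 - e2)%X = (n1 - n2)%N%:Z.
Proof. by move=> /= -> -> /subzn. Qed.

Lemma ev_mul e1 e2 n1 n2 : eval st e1 = n1%:Z -> eval st e2 = n2%:Z ->
  eval st (e1 * e2)%X = (n1 * n2)%N%:Z.
Proof. by move=> /= -> ->. Qed.

Lemma ev_div e1 e2 n1 n2 : eval st e1 = n1%:Z -> eval st e2 = n2%:Z ->
  eval st (e1 / e2)%X = (n1 %/ n2)%N%:Z.
Proof. by move=> /= -> ->; rewrite divz_nat. Qed.

Lemma ev_mod e1 e2 n1 n2 : eval st e1 = n1%:Z -> eval st e2 = n2%:Z ->
  eval st (e1 %% e2)%X = (n1 %% n2)%N%:Z.
Proof. by move=> /= -> ->; rewrite modz_nat. Qed.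

Lemma ev_get b e n : eval st e = n%:Z -> eval st (Get b e) = arrs st b n%:Z.
Proof. by move=> /= ->. Qed.

Lemma ev_lt e1 e2 n1 n2 : eval st e1 = n1%:Z -> eval st e2 = n2%:Z ->
  eval st (xlt e1 e2) = (n1 < n2)%N%:Z.
Proof. by move=> /= -> ->; rewrite -PoszD addn1 lez_nat; case: ifP. Qed.

Lemma ev_eq e1 e2 n1 n2 : eval st e1 = n1%:Z -> eval st e2 = n2%:Z ->
  eval st (xeq e1 e2) = (n1 == n2)%:Z.
Proof. by move=> /= -> ->; rewrite eqz_nat; case: ifP. Qed.

Lemma ev_ite c (b : bool) e1 e2 : eval st c = b%:Z ->
  eval st (xite c e1 e2) = if b then eval st e1 else eval st e2.
Proof.
by case: b => /= ->; rewrite ?(subrr, subr0, mul1r, mul0r, addr0, add0r).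
Qed.

End Evaluation.

(** Arrays: 2, 3 hold [2 ^ min(t, k)] and [min(t, k)]; 4 the powers of [N p];
    6, 7 inverses and factorials; 8, 9 [1 / t!] and [(-1)^t / t!]; 10 the
    largest power of 2 up to [t]; 12, 13 the twiddle factors; 14 the sequences
    to be convolved; 16, 17 their transforms; 18, 19 the inverse transforms of
    the products; 20 the values of [f]; 22 the partial sums of their squares.
    Arrays 5, 11, 15, 21, 23, 24 only receive zeros. *)
Definition xT : expr := Var 2.
Definition xM : expr := Var 0.
Definition xP : expr := Var 1.
(** As [k <= 3m], cell [3m] lies where the capped powers of 2 have become constant. *)
Definition xN : expr := (Get 2 (#3 * xM))%X.
Definition xK : expr := (Get 3 (#3 * xM))%X.
Definition xS : expr := (Get 4 #13)%X.

Definition pow_bd : expr := ((#3 * xM) + #1)%X.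
(** The entry is doubled exactly while it is below [3m], which locates [N] without a logarithm. *)
Definition pow_e1 : expr :=
  (xite (xeq xT #0) #1
  (Get 2 (xT - #1) * (#1 + xlt (Get 2 (xT - #1)) (#3 * xM))))%X.
Definition pow_e2 : expr :=
  (xite (xeq xT #0) #0
  (Get 3 (xT - #1) + xlt (Get 2 (xT - #1)) (#3 * xM)))%X.

Definition scale_bd : expr := #14%X.
Definition scale_e1 : expr :=
  (xite (xeq xT #0) #1 (Get 4 (xT - #1) * (xN * xP)))%X.

Definition inv_bd : expr := (#2 * xM)%X.
Definition inv_e1 : expr :=
  (xite (xlt xT #2) xT
  (((xP - (xP / xT)) * Get 6 (xP %% xT)) %% xP))%X.
Definition inv_e2 : expr :=
  (xite (xeq xT #0) #1 ((Get 7 (xT - #1) * xT) %% xP))%X.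

Definition ifact_bd : expr := xM.
Definition ifact_e1 : expr :=
  (xite (xeq xT #0) #1 ((Get 8 (xT - #1) * Get 6 xT) %% xP))%X.
Definition ifact_e2 : expr :=
  (xite (xeq xT #0) #1
  (((xP - Get 9 (xT - #1)) * Get 6 xT) %% xP))%X.

Definition top_bd : expr := xN.
Definition top_e1 : expr := (xite (xlt xT #2) xT (#2 * Get 10 (xT / #2)))%X.

Definition tw_bd : expr := xN.
Definition tw_top : expr := (Get 10 xT)%X.
(** Half-angle formula scaled by [S]: the cell [t / 2] approximates [S c], and the root of
    [(S^2 + S c S) / 2] is [S] times the cosine of half the angle. *)
Definition tw_cos : expr :=
  (Sqrt (((xS * xS) + (Get 12 (xT / #2) * xS)) / #2))%X.
Definition tw_e1 : expr :=
  (xite (xeq xT #0) xS (xite (xeq xT #1) #0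
  (xite (xeq tw_top xT) tw_cos
    (((Get 12 (xT - tw_top) * Get 12 tw_top) -
      (Get 13 (xT - tw_top) * Get 13 tw_top)) / xS))))%X.
Definition tw_e2 : expr :=
  (xite (xeq xT #0) #0 (xite (xeq xT #1) xS
  (xite (xeq tw_top xT) ((Get 13 (xT / #2) * xS) / (#2 * tw_cos))
    (((Get 12 (xT - tw_top) * Get 13 tw_top) +
      (Get 13 (xT - tw_top) * Get 12 tw_top)) / xS))))%X.

Definition coef_bd : expr := ((xM + #1) * xN)%X.
Definition coef_y : expr := (xT / xN)%X.
Definition coef_x : expr := (xT %% xN)%X.
Definition coef_e1 : expr :=
  (xite (xlt coef_y xM)
  (xite (xlt coef_x xM)
     (((Get 0 ((coef_x * xM) + coef_y) * Get 8 coef_x) *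
        Get 9 ((xM - #1) - coef_x)) %% xP) #0)
  (xite (xlt coef_x (#2 * xM)) (Get 6 coef_x) #0))%X.

(** The transforms of all rows are stored level by level: level [l] of row [y]
    occupies the cells [(y * (k + 1) + l) * N + i] with [i < N]. *)
Definition fft_y : expr := ((xT / xN) / (xK + #1))%X.
Definition fft_l : expr := ((xT / xN) %% (xK + #1))%X.
Definition fft_i : expr := (xT %% xN)%X.
Definition fft_odd (H : expr) : expr := ((fft_i / H) %% #2)%X.
Definition fft_b (H : expr) : expr := (fft_i / (#2 * H))%X.
(** The same position of the same row, one level earlier, lies [N] cells back. *)
Definition fft_lo (H : expr) : expr := ((xT - xN) - (fft_odd H * H))%X.
Definition fft_hi (H : expr) : expr := (fft_lo H + H)%X.
Definition last_level (y : expr) : expr :=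
  ((((y * (xK + #1)) + xK) * xN) + fft_i)%X.

Definition fwd_bd : expr := (((xM + #1) * (xK + #1)) * xN)%X.
Definition fwd_H : expr := (Get 2 (xK - fft_l))%X.
Definition fwd_sgn : expr := (#1 - (#2 * fft_odd fwd_H))%X.
Definition fwd_e1 : expr :=
  (xite (xeq fft_l #0) (Get 14 ((fft_y * xN) + fft_i) * xS)
  (Get 16 (fft_lo fwd_H) + (fwd_sgn *
    (((Get 12 (fft_b fwd_H) * Get 16 (fft_hi fwd_H)) -
      (Get 13 (fft_b fwd_H) * Get 17 (fft_hi fwd_H))) / xS))))%X.
Definition fwd_e2 : expr :=
  (xite (xeq fft_l #0) #0
  (Get 17 (fft_lo fwd_H) + (fwd_sgn *
    (((Get 12 (fft_b fwd_H) * Get 17 (fft_hi fwd_H)) +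
      (Get 13 (fft_b fwd_H) * Get 16 (fft_hi fwd_H))) / xS))))%X.

Definition bwd_bd : expr := ((xM * (xK + #1)) * xN)%X.
(** Backward level [l] returns to forward level [k - l], undoing butterflies whose half-blocks have
    length [2 ^ (l - 1)]. *)
Definition bwd_H : expr := (Get 2 (fft_l - #1))%X.
Definition bwd_d1 : expr := (Get 18 (fft_lo bwd_H) - Get 18 (fft_hi bwd_H))%X.
Definition bwd_d2 : expr := (Get 19 (fft_lo bwd_H) - Get 19 (fft_hi bwd_H))%X.
Definition bwd_e1 : expr :=
  (xite (xeq fft_l #0)
  (((Get 16 (last_level fft_y) * Get 16 (last_level xM)) -
    (Get 17 (last_level fft_y) * Get 17 (last_level xM))) / xS)
  (xite (xeq (fft_odd bwd_H) #0)
    (Get 18 (fft_lo bwd_H) + Get 18 (fft_hi bwd_H))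
    (((Get 12 (fft_b bwd_H) * bwd_d1) - ((#0 - Get 13 (fft_b bwd_H)) * bwd_d2))
       / xS)))%X.
Definition bwd_e2 : expr :=
  (xite (xeq fft_l #0)
  (((Get 16 (last_level fft_y) * Get 17 (last_level xM)) +
    (Get 17 (last_level fft_y) * Get 16 (last_level xM))) / xS)
  (xite (xeq (fft_odd bwd_H) #0)
    (Get 19 (fft_lo bwd_H) + Get 19 (fft_hi bwd_H))
    (((Get 12 (fft_b bwd_H) * bwd_d2) + ((#0 - Get 13 (fft_b bwd_H)) * bwd_d1))
       / xS)))%X.

Definition val_bd : expr := ((#2 * xM) * xM)%X.
Definition val_j : expr := (xT / xM)%X.
Definition val_y : expr := (xT %% xM)%X.
Definition val_e1 : expr :=
  (xite (xlt val_j xM) (Get 0 xT)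
  ((((((#2 * Get 18 ((((val_y * (xK + #1)) + xK) * xN) + val_j)) + (xS * xN))
       / (#2 * (xS * xN))) * Get 7 val_j) * Get 8 (val_j - xM)) %% xP))%X.

Definition sum_e1 : expr :=
  ((xite (xeq val_y #0) #0 (Get 22 (xT - #1)) + (Get 20 xT * Get 20 xT)) %% xP)%X.

Definition out_bd : expr := (#2 * xM)%X.
Definition out_e1 : expr := (Get 22 (((xT %% xP) * xM) + (xM - #1)))%X.

(** Bounds the degree of every subexpression of the program, as computation confirms loop by loop;
    its size affects only the constant of the bit bound. *)
Definition degree_bound : nat := 50.

Definition phases : seq (nat * nat * (expr * expr * expr)) :=
  [:: (2, 3, (pow_bd, pow_e1, pow_e2)); (4, 5, (scale_bd, scale_e1, Const 0));
      (6, 7, (inv_bd, inv_e1, inv_e2)); (8, 9, (ifact_bd, ifact_e1, ifact_e2));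
      (10, 11, (top_bd, top_e1, Const 0)); (12, 13, (tw_bd, tw_e1, tw_e2));
      (14, 15, (coef_bd, coef_e1, Const 0)); (16, 17, (fwd_bd, fwd_e1, fwd_e2));
      (18, 19, (bwd_bd, bwd_e1, bwd_e2)); (20, 21, (val_bd, val_e1, Const 0));
      (22, 23, (val_bd, sum_e1, Const 0)); (1, 24, (out_bd, out_e1, Const 0)) ]%N.

Definition prover : cmd :=
  foldr (fun f => Seq (phase f.1.1 f.1.2 f.2.1.1 f.2.1.2 f.2.2)) Skip phases.

Definition prover_cost : nat :=
  foldr (fun f c => phase_cost f.2.1.1 f.2.1.2 f.2.2 + c)%N 1%N phases.

(** * Correctness of the loops *)

Local Arguments eval : simpl never.


Section Size.
Variables (p m : nat).

Definition lgN : nat := up_log 2 (3 * m).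
Definition sizeN : nat := 2 ^ lgN.
Definition scale : nat := (sizeN * p) ^ 13.
Local Notation k := lgN.
Local Notation N := sizeN.

Lemma sizeN_ge : (3 * m <= N)%N. Proof. exact: up_logP. Qed.

Lemma lgN_le : (k <= 3 * m)%N.
Proof. by apply: up_log_min => //; apply: ltnW; apply: ltn_expl. Qed.

Lemma lgN_lt : (k < N)%N. Proof. exact: ltn_expl. Qed.

Hypothesis m_gt1 : (1 < m)%N.

Lemma sizeN_lt : (N < 6 * m)%N.
Proof.
have m3 : (1 < 3 * m)%N by lia.
have := @up_log_gtn 2 (3 * m) isT m3; rewrite /sizeN -/lgN.
have : (0 < k)%N by rewrite up_log_gt0 m3.
case: k => // n _ /=; rewrite expnS; lia.
Qed.

Lemma sizeN_ge8 : (8 <= N)%N.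
Proof.
have := sizeN_ge; rewrite /sizeN; case: k => [|[|[|n]]]; try lia.
by move=> _; rewrite (@leq_pexp2l 2 3).
Qed.

End Size.

(** * Loops with exact values: powers, inverses, factorials, convolution data *)

Section Exact.
Variables (p m : nat) (f : {poly {poly 'F_p}}).
Hypotheses (p_pr : prime p) (m_gt1 : (1 < m)%N) (m_le_p : (m <= p)%N).
Local Notation k := (lgN m).
Local Notation N := (sizeN m).

Definition phi (u : 'F_p) : int := (u : nat)%:Z.

Lemma phi_lt u : (`|phi u| < p)%N. Proof. exact: Fp_lt. Qed.

Lemma modz_phi (n : nat) : (n%:Z %% p)%Z = phi n%:R.
Proof. by rewrite modz_nat /phi (@val_Fp_nat p). Qed.

Lemma phi_nat (n : nat) : (n < p)%N -> phi n%:R = n%:Z.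
Proof. by move=> np; rewrite /phi (@val_Fp_nat p) // modn_small. Qed.

(** For [t >= p] the recursion reads cell [p mod t], which is cell 0 or cell [p]; both hold 0, so 0
    is what the table contains there. Values at [j < p] never use these entries. *)
Definition ivF (t : nat) : 'F_p := if (t < p)%N then t%:R^-1 else 0.

Definition coefF (y x : nat) : 'F_p :=
  if (x < m)%N then
    (row_poly f y).[x%:R] * (x`!)%:R^-1 * ((-1) ^+ (m.-1 - x) * ((m.-1 -
      x)`!)%:R^-1)
  else 0.

(** Row [m] holds the Cauchy kernel with which all other rows are convolved. *)
Definition coef (y x : nat) : int :=
  phi (if (y < m)%N then coefF y x else if (x < 2 * m)%N then ivF x else 0).

Definition in_fact := Fact 0 25 (m * m)
  (fun t v1 _ => v1 = phi (row_poly f (t %% m)).[(t %/ m)%:R]).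

Definition pow_fact := Fact 2 3 (3 * m + 1)
  (fun t v1 v2 => v1 = (2 ^ minn t k)%N%:Z /\ v2 = (minn t k)%:Z).

Definition scale_fact := Fact 4 5 14
  (fun t v1 v2 => v1 = ((N * p) ^ t)%N%:Z /\ v2 = 0).

Definition inv_fact := Fact 6 7 (2 * m)
  (fun t v1 v2 => v1 = phi (ivF t) /\ v2 = phi (t`!)%:R).

Definition ifact_fact := Fact 8 9 m
  (fun t v1 v2 => v1 = phi (t`!)%:R^-1 /\ v2 = phi ((-1) ^+ t * (t`!)%:R^-1)).

Definition top_fact := Fact 10 11 N
  (fun t v1 v2 =>
     v1 = (if t == 0%N then 0%N else 2 ^ trunc_log 2 t)%N%:Z /\ v2 = 0).

Definition coef_fact := Fact 14 15 ((m + 1) * N)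
  (fun t v1 v2 => v1 = coef (t %/ N) (t %% N) /\ v2 = 0).

Section State.
Variable st : state.
Hypotheses (v0 : vars st 0 = m%:Z) (v1 : vars st 1 = p%:Z).

Lemma ev_M : eval st xM = m%:Z. Proof. exact: v0. Qed.
Lemma ev_P : eval st xP = p%:Z. Proof. exact: v1. Qed.
Lemma ev_const (n : nat) : eval st (Const n%:Z) = n%:Z. Proof. by []. Qed.

Lemma ev_3M : eval st (Bin Mul (Const 3) xM) = (3 * m)%N%:Z.
Proof. exact: ev_mul ev_M. Qed.

Section Loop.
Variable t : nat.
Hypothesis v2 : vars st 2 = t%:Z.

Lemma ev_T : eval st xT = t%:Z. Proof. exact: v2. Qed.

Lemma ev_pred : (0 < t)%N -> eval st (Bin Defs.Sub xT (Const 1)) = t.-1%:Z.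
Proof. by move=> t0; rewrite -subn1; apply: ev_sub ev_T _ t0. Qed.

Lemma ev_T0 e1 e2 : eval st (xite (xeq xT (Const 0)) e1 e2) =
  if t == 0%N then eval st e1 else eval st e2.
Proof. by apply: ev_ite; apply: ev_eq ev_T _. Qed.

Lemma pow_step : (t < 3 * m + 1)%N ->
  holds (arrs st) (Fact 2 3 t (fspec pow_fact)) ->
  fspec pow_fact t (eval st pow_e1) (eval st pow_e2).
Proof.
move=> tm h; rewrite /pow_e1 /pow_e2 !ev_T0.
case: eqP => [->|/eqP t0]; first by rewrite /= min0n expn0.
have t0' : (0 < t)%N by lia.
have [] := h t.-1; first by rewrite /= prednK.
rewrite -!(ev_get _ (ev_pred t0')) => g2 g3.
have c : eval st (xlt (Get 2 (Bin Defs.Sub xT (Const 1))) (Bin Mul (Const 3) xM)) =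
    (2 ^ minn t.-1 k < 3 * m)%N%:Z by exact: ev_lt g2 ev_3M.
rewrite (ev_mul g2 (ev_add (ev_const 1) c)) (ev_add g3 c) /=.
have [tk|kt] := ltnP t.-1 k.
  have -> : (2 ^ t.-1 < 3 * m)%N.
    by rewrite ltnNge; apply/negP => /(up_log_min (isT : 1 < 2)%N);
      rewrite -/(lgN m); lia.
  have -> : minn t k = t.-1.+1 by lia.
  by rewrite expnS /=; split; congr Posz; lia.
have -> : (2 ^ k < 3 * m)%N = false by have := sizeN_ge m; rewrite /sizeN; lia.
have -> : minn t k = k by lia.
by split; congr Posz; lia.
Qed.

End Loop.

Section WithPow.
Hypothesis hpow : holds (arrs st) pow_fact.

Lemma ev_pow2 e j : eval st e = j%:Z -> (j <= k)%N ->
  eval st (Get 2 e) = (2 ^ j)%N%:Z.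
Proof.
move=> ej jk; rewrite (ev_get _ ej); have [] := hpow (t := j).
  by rewrite /=; have := lgN_le m; lia.
by move=> -> _; rewrite (minn_idPl jk).
Qed.

Lemma ev_N : eval st xN = N%:Z.
Proof.
rewrite (ev_get _ ev_3M); have [] := hpow (t := 3 * m); first by rewrite /=; lia.
by move=> -> _; rewrite (minn_idPr (lgN_le m)).
Qed.

Lemma ev_K : eval st xK = k%:Z.
Proof.
rewrite (ev_get _ ev_3M); have [] := hpow (t := 3 * m); first by rewrite /=; lia.
by move=> _ ->; rewrite (minn_idPr (lgN_le m)).
Qed.

Section Loop.
Variable t : nat.
Hypothesis v2 : vars st 2 = t%:Z.

Lemma scale_step : holds (arrs st) (Fact 4 5 t (fspec scale_fact)) ->
  fspec scale_fact t (eval st scale_e1) (eval st (Const 0)).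
Proof.
move=> h; rewrite /scale_e1 (ev_T0 v2); case: eqP => [->|/eqP t0] //.
have t0' : (0 < t)%N by lia.
have [] := h t.-1; first by rewrite /= prednK.
rewrite -!(ev_get _ (ev_pred v2 t0')) => g4 _; split=> //.
by rewrite (ev_mul g4 (ev_mul ev_N ev_P)) -expnSr prednK.
Qed.

Lemma top_step : holds (arrs st) (Fact 10 11 t (fspec top_fact)) ->
  fspec top_fact t (eval st top_e1) (eval st (Const 0)).
Proof.
move=> h; split=> //; rewrite /top_e1 (ev_ite _ _ (ev_lt (ev_T v2) (ev_const 2))).
case: (ltnP t 2) => t2; first by rewrite (ev_T v2); case: t t2 => [|[]].
have e : eval st (Bin Div xT (Const 2)) = (t %/ 2)%N%:Z by exact: ev_div (ev_T v2)
  _.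
have [] := h (t %/ 2)%N; first by rewrite /= ltn_Pdiv //; lia.
rewrite -!(ev_get _ e) => g _; rewrite (ev_mul (ev_const 2) g).
have -> : (t %/ 2 == 0)%N = false by lia.
have -> : (t == 0)%N = false by lia.
by rewrite -expnS divn2 -(trunc_log2S t2).
Qed.

End Loop.
End WithPow.

Section Loop.
Variable t : nat.
Hypothesis v2 : vars st 2 = t%:Z.

Lemma inv_step : (t < 2 * m)%N -> holds (arrs st) (Fact 6 7 t (fspec inv_fact)) ->
  fspec inv_fact t (eval st inv_e1) (eval st inv_e2).
Proof.
move=> tm h; split.
  rewrite /inv_e1 (ev_ite _ _ (ev_lt (ev_T v2) (ev_const 2))) (ev_T v2).
  have p1 := prime_gt1 p_pr.
  case: (ltnP t 2) => t2.
    case: t t2 => [|[]] // _; rewrite /ivF ?prime_gt0 ?p1 ?invr0 // invr1.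
    by rewrite (@phi_nat 1).
  have e : eval st (Bin Mod xP xT) = (p %% t)%N%:Z by exact: ev_mod ev_P (ev_T v2).
  have [] := h (p %% t)%N; first by rewrite /= ltn_pmod //; lia.
  rewrite -!(ev_get _ e) => g _.
  have e1 : eval st (Bin Defs.Sub xP (Bin Div xP xT)) = (p - p %/ t)%N%:Z.
    by apply: ev_sub ev_P (ev_div ev_P (ev_T v2)) _; exact: leq_div.
  rewrite (ev_mod (ev_mul e1 g) ev_P) -modz_nat modz_phi natrM Fp_natK.
  congr phi; rewrite /ivF; case: (ltnP t p) => tp; last first.
    move: tp; rewrite leq_eqVlt => /orP[/eqP tp|tp].
      by rewrite -tp divnn prime_gt0 // modnn prime_gt0 // invr0 mulr0.
    by rewrite modn_small // ltnn mulr0.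
  have pt : (p %% t < p)%N by apply: ltn_trans tp; rewrite ltn_pmod //; lia.
  rewrite pt.
  have pt0 : (0 < p %% t)%N.
    rewrite lt0n; apply/negP => /eqP/eqP d; case/primeP: p_pr => _ /(_ t d); lia.
  have nz1 : (p %% t)%:R != 0 :> 'F_p by rewrite natr_Fp_nz // pt0.
  have nz2 : t%:R != 0 :> 'F_p by rewrite natr_Fp_nz //; lia.
  apply: (mulIf nz2); rewrite mulVf //; apply: (mulIf nz1).
  rewrite mul1r mulrAC mulfVK // natrB ?leq_div //.
  have := congr1 (fun n => n%:R : 'F_p) (divn_eq p t); rewrite natrD natrM.
  have -> : p%:R = 0 :> 'F_p by apply/eqP; rewrite natr_Fp_eq0.
  by move/eqP; rewrite eq_sym addrC addr_eq0 => /eqP->; rewrite sub0r mulNr.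
rewrite /inv_e2 (ev_T0 v2); case: eqP => [->|/eqP t0].
  by rewrite fact0 (@phi_nat 1) ?prime_gt1.
have t0' : (0 < t)%N by lia.
have [] := h t.-1; first by rewrite /= prednK.
rewrite -!(ev_get _ (ev_pred v2 t0')) => _ g.
rewrite (ev_mod (ev_mul g (ev_T v2)) ev_P) -modz_nat modz_phi natrM Fp_natK.
by rewrite -natrM mulnC -{1}(prednK t0') -factS prednK.
Qed.

Lemma ifact_step : holds (arrs st) inv_fact -> (t < m)%N ->
  holds (arrs st) (Fact 8 9 t (fspec ifact_fact)) ->
  fspec ifact_fact t (eval st ifact_e1) (eval st ifact_e2).
Proof.
move=> hinv tm h; rewrite /ifact_e1 /ifact_e2 !(ev_T0 v2).
case: eqP => [->|/eqP t0].
  by split; rewrite -[(0`!)%:R]/(1 : 'F_p) ?expr0 ?mul1r invr1 (@phi_nat 1)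
    ?prime_gt1.
have t0' : (0 < t)%N by lia.
have [] := h t.-1; first by rewrite /= prednK.
rewrite -!(ev_get _ (ev_pred v2 t0')) => g8 g9.
have [] := hinv t; first by rewrite /=; lia.
rewrite -!(ev_get _ (ev_T v2)) => g6 _.
have iv : ivF t = t%:R^-1 by rewrite /ivF (leq_trans tm).
have fE : (t`!)%:R^-1 = (t.-1`!)%:R^-1 * t%:R^-1 :> 'F_p.
  by rewrite -{1}(prednK t0') factS prednK // natrM invfM mulrC.
split.
  by rewrite (ev_mod (ev_mul g8 g6) ev_P) -modz_nat modz_phi natrM !Fp_natK iv -fE.
have g9' : eval st (Bin Defs.Sub xP (Get 9 (Bin Defs.Sub xT (Const 1)))) =
    (p - ((-1) ^+ t.-1 * (t.-1`!)%:R^-1 : 'F_p)%R : nat)%N%:Z.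
  by apply: ev_sub ev_P g9 _; exact: ltnW (Fp_lt _ _).
rewrite (ev_mod (ev_mul g9' g6) ev_P) -modz_nat modz_phi natrM natrB;
  last exact: ltnW (Fp_lt _ _).
rewrite !Fp_natK iv fE; congr phi.
have -> : p%:R = 0 :> 'F_p by apply/eqP; rewrite natr_Fp_eq0.
have -> : (-1) ^+ t = - (-1) ^+ t.-1 :> 'F_p by rewrite -{1}(prednK t0') exprS
  mulN1r.
by rewrite sub0r !mulNr mulrA.
Qed.

Lemma coef_step : holds (arrs st) in_fact -> holds (arrs st) pow_fact ->
  holds (arrs st) inv_fact -> holds (arrs st) ifact_fact -> (t < (m + 1) * N)%N ->
  fspec coef_fact t (eval st coef_e1) (eval st (Const 0)).
Proof.
move=> hin hpow hinv hif tm; split=> //.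
have N0 : (0 < N)%N by rewrite expn_gt0.
have ey : eval st coef_y = (t %/ N)%N%:Z by exact: ev_div (ev_T v2) (ev_N hpow).
have ex : eval st coef_x = (t %% N)%N%:Z by exact: ev_mod (ev_T v2) (ev_N hpow).
move: (t %/ N)%N (t %% N)%N ey ex => y x ey ex.
rewrite /coef_e1 (ev_ite _ _ (ev_lt ey ev_M)) /coef.
case: (ltnP y m) => ym; last first.
  rewrite (ev_ite _ _ (ev_lt ex (ev_mul (ev_const 2) ev_M))).
  case: (ltnP x (2 * m)) => xm //.
  by rewrite (ev_get _ ex); have [] := hinv x xm.
rewrite (ev_ite _ _ (ev_lt ex ev_M)) /coefF; case: (ltnP x m) => xm //.
have ei := ev_add (ev_mul ex ev_M) ey.
have im : (x * m + y < m * m)%N by nia.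
have := hin _ im; rewrite /= divnMDl ?(divn_small ym) ?modnMDl ?(modn_small ym)
  ?addn0; last by lia.
rewrite -(ev_get _ ei) => g0.
have [] := hif x xm; rewrite /= -!(ev_get _ ex) => g8 _.
have ej : eval st (Bin Defs.Sub (Bin Defs.Sub xM (Const 1)) coef_x) = (m.-1 -
  x)%N%:Z.
  by rewrite -subn1; apply: ev_sub (ev_sub ev_M (ev_const 1) _) ex _; lia.
have [] := hif (m.-1 - x)%N; first by rewrite /=; lia.
rewrite /= -!(ev_get _ ej) => _ g9.
by rewrite (ev_mod (ev_mul (ev_mul g0 g8) g9) ev_P) -modz_nat modz_phi !natrM
  !Fp_natK.
Qed.

End Loop.
End State.
End Exact.

(** A twiddle factor has norm at most 2, so a butterfly at most triples the bound; the base 4 is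
    convenient because [4 ^ k] is [N ^ 2] when [N = 2 ^ k]. *)
Lemma fft_norm1 (R : rcfType) (k : nat) (w c : nat -> R[i]) (M : R) l i :
  (forall b, norm1 (w b) <= 2) ->
  (forall j, (j < 2 ^ k)%N -> norm1 (c j) <= M) ->
  (l <= k)%N -> (i < 2 ^ k)%N -> norm1 (fft k w c l i) <= 4 ^+ l * M.
Proof.
move=> hw hc; elim: l i => [|l IH] i lk ik; first by rewrite expr0 mul1r hc.
rewrite /=; set H := (2 ^ (k - l.+1))%N.
have H0 : (0 < H)%N by rewrite expn_gt0.
have eN : (2 ^ k = 2 ^ l * (2 * H))%N by rewrite /H -expnS -expnD;
  congr (_ ^ _)%N; lia.
have lo : norm1 (fft k w c l (lower H i)) <= 4 ^+ l * M.
  by apply: IH; [exact: ltnW | exact: leq_ltn_trans (lower_leq _ _) ik].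
have hi : norm1 (fft k w c l (lower H i + H)) <= 4 ^+ l * M.
  by apply: IH; [exact: ltnW | rewrite eN upper_lt // -eN].
apply: le_trans (norm1D _ _) _; rewrite norm1_sign.
have := norm1M (w (i %/ (2 * H))%N) (fft k w c l (lower H i + H)).
have := ler_pM (norm1_ge0 _) (norm1_ge0 _) (hw (i %/ (2 * H))%N) hi.
have := norm1_ge0 (fft k w c l (lower H i)).
by move: (norm1 _) (norm1 _) (norm1 _) lo => *; rewrite exprS; lra.
Qed.

(** * Rounding errors of twiddle factors and transforms *)

Section Approx.
Variables (R : rcfType) (p m : nat) (f : {poly {poly 'F_p}}).
Hypotheses (p_pr : prime p) (m_gt1 : (1 < m)%N) (m_le_p : (m <= p)%N).
Local Notation k := (lgN m).
Local Notation N := (sizeN m).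
Local Notation S := ((scale p m)%:Z).
Local Notation s := ((scale p m)%:R : R).
Local Notation w := (tw R k).
Local Notation approx e := (@close R S e).

Lemma scale_big : (100 * (p ^ 2 * N ^ 12) <= scale p m)%N.
Proof.
have p2 := prime_gt1 p_pr; have N8 := sizeN_ge8 m_gt1.
have -> : scale p m = (p ^ 11 * N * (p ^ 2 * N ^ 12))%N.
  by rewrite /scale expnMn (expnD N 1 12) (expnD p 11 2) expn1; lia.
apply: leq_mul => //; have : (2 ^ 11 <= p ^ 11)%N by rewrite leq_exp2r.
move: (p ^ 11)%N => q; have -> : (2 ^ 11 = 2048)%N by []. nia.
Qed.

Lemma scale_gt0 : (0 < scale p m)%N.
Proof. by rewrite /scale /sizeN !(expn_gt0, muln_gt0) (prime_gt0 p_pr). Qed.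

Lemma S_gt0 : 0 < S :> int. Proof. by have := scale_gt0; lia. Qed.

(** Turns a constant factor per level into a power of [N]. *)
Lemma expN c j : (j <= k)%N -> ((2 ^ c) ^ j <= N ^ c)%N.
Proof.
case: c => [|c] jk; first by rewrite !expn0 exp1n.
by rewrite -expnM mulnC expnM leq_exp2r // leq_exp2l.
Qed.

Lemma w_norm b : norm1 (w b) <= 2.
Proof. exact: unitary_norm1 (tw_unitary _ _ _). Qed.

(** Two invariants interlock. At powers of 2 the bound [2 * 8^h - 2] per coordinate survives a
    half-angle step, as [8 e + 13] then stays below [2 * 8^(h+1) - 2]. For other entries, [closeM]
    gives at most [14 * 8^h - 6], within [2 * 8^(h+1)]. *)
Definition tw_fact := Fact 12 13 N (fun t v1 v2 =>
  (forall h, (t < 2 ^ h)%N -> approx (2 * 8 ^+ h) v1 v2 (w t)) /\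
  (forall h, t = (2 ^ h)%N ->
     `|v1%:~R - s * (cos_sin R h).1| <= 2 * 8 ^+ h - 2 /\
     `|v2%:~R - s * (cos_sin R h).2| <= 2 * 8 ^+ h - 2)).

Definition fwd_error : nat := 6 * p * N ^ 5.
(** Two leaves of norm at most [N^2 p], each with error [6 p N^7], have a product with error about
    [12 p^2 N^9]. *)
Definition bwd_error : nat := 20 * p ^ 2 * N ^ 9.

Definition rowC (y j : nat) : R[i] := (coef m f y j)%:~R.
Definition convC (y j : nat) : R[i] :=
  \sum_(x < j.+1) rowC y x * rowC m (j - x).

Local Notation row t := ((t %/ N) %/ (k + 1))%N.
Local Notation level t := ((t %/ N) %% (k + 1))%N.
Local Notation pos t := (t %% N)%N.

Definition fwd_fact := Fact 16 17 ((m + 1) * (k + 1) * N) (fun t v1 v2 =>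
  approx (4 ^ level t * fwd_error)%N%:R v1 v2
    (fft k w (rowC (row t)) (level t) (pos t))).

(** The reference is the forward transform of the exact convolution: the leaves agree by [fft_conv],
    and each backward level recovers the preceding forward level, doubled. *)
Definition bwd_fact := Fact 18 19 (m * (k + 1) * N) (fun t v1 v2 =>
  approx (5 ^ level t * bwd_error)%N%:R v1 v2
    ((2 ^ level t)%:R * fft k w (convC (row t)) (k - level t) (pos t))).

(** For [j >= p] the factorial formula fails, and the cells are only required to stay in [[0, p)];
    the output loop reads only sums with [j < p]. *)
Definition val_fact := Fact 20 21 (2 * m * m) (fun t v1 v2 =>
  (exists2 n : nat, v1 = n%:Z & (n < p)%N) /\
  ((t %/ m < p)%N -> v1 = phi (row_poly f (t %% m)).[(t %/ m)%:R]) /\ v2 = 0).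

Definition sum_fact := Fact 22 23 (2 * m * m) (fun t v1 v2 =>
  (exists2 n : nat, v1 = n%:Z & (n < p)%N) /\
  ((t %/ m < p)%N -> v1 = phi (\sum_(0 <= y < (t %% m).+1)
     (row_poly f y).[(t %/ m)%:R] ^+ 2)) /\ v2 = 0).

Definition out_fact := Fact 1 24 (2 * m) (fun t v1 v2 =>
  v1 = phi (honest_poly m f).[t%:R] /\ v2 = 0).

Lemma rho_unitary h : unitary (rho R h).
Proof. by have [] := cos_sinP R h. Qed.

Lemma close_rho e u v h : `|u%:~R - s * (cos_sin R h).1| <= e ->
  `|v%:~R - s * (cos_sin R h).2| <= e -> approx (2 * e) u v (rho R h).
Proof.
move=> hu hv; rewrite /close /norm1 /rho /= -[S%:~R]/s.
rewrite (_ : s * _ - 0 * _ = s * (cos_sin R h).1); last by ring.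
rewrite (_ : s * _ + 0 * _ = s * (cos_sin R h).2); last by ring.
by rewrite mulrDl mul1r lerD.
Qed.

Lemma cellP y l i (c := ((y * (k + 1) + l) * N + i)%N) :
  (l <= k)%N -> (i < N)%N -> [/\ row c = y, level c = l & pos c = i].
Proof.
move=> lk iN; have N0 : (0 < N)%N by exact: leq_ltn_trans iN.
have cN : (c %/ N = y * (k + 1) + l)%N by rewrite divnMDl // (divn_small iN) addn0.
rewrite cN; split; last by rewrite modnMDl modn_small.
  by rewrite divnMDl ?divn_small ?addn0 // addn1.
by rewrite modnMDl modn_small // addn1.
Qed.

Lemma cell_eq c : c = ((row c * (k + 1) + level c) * N + pos c)%N.
Proof. by rewrite -!divn_eq. Qed.

Lemma level_le c : (level c <= k)%N.
Proof. by rewrite -ltnS -[X in (_ < X)%N]addn1 ltn_pmod // addn1. Qed.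

Lemma pos_lt c : (pos c < N)%N.
Proof. by rewrite ltn_pmod // /sizeN expn_gt0. Qed.

Lemma rowC_norm y j : norm1 (rowC y j) <= p%:R.
Proof.
rewrite /rowC /coef /phi; move: (if _ then _ else _) => u.
by rewrite -[(_%:Z)%:~R]/((u : nat)%:R) norm1_nat ler_nat (ltnW (Fp_lt p_pr u)).
Qed.

Lemma natr_le (a b : nat) : (a <= b)%N -> a%:R <= b%:R :> R.
Proof. by rewrite ler_nat. Qed.

(** The inputs of a butterfly enter with weights 1 and 2. The twiddle error [2 N^3] times an entry
    of size [4^l p], plus the floors, is absorbed by one more copy of the old bound. *)
Lemma fwd_error_step l : (l <= k)%N ->
  (3 * (4 ^ l * fwd_error) + (2 * N ^ 3 * (4 ^ l * p + 1) + 2) <=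
   4 ^ l.+1 * fwd_error)%N.
Proof.
move=> lk; have := expN 2 lk; have -> : (2 ^ 2 = 4)%N by [].
have -> : (4 ^ l.+1 * fwd_error = 3 * (4 ^ l * fwd_error) + 4 ^ l * fwd_error)%N.
  by rewrite expnS; lia.
rewrite leq_add2l /fwd_error; have -> : (N ^ 5 = N ^ 3 * N ^ 2)%N by rewrite -expnD.
have N3 : (0 < N ^ 3)%N by rewrite !expn_gt0.
have p0 := prime_gt0 p_pr; have l0 : (0 < 4 ^ l)%N by rewrite expn_gt0.
have N2 : (0 < N ^ 2)%N by rewrite !expn_gt0.
move: (N ^ 3)%N (N ^ 2)%N (4 ^ l)%N N3 N2 l0 => a b c a0 b0 c0 cb.
have -> : (c * (6 * p * (a * b)) = 6 * (a * (c * p)) * b)%N by ring.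
have u1 : (a <= a * (c * p))%N by rewrite leq_pmulr // muln_gt0 c0.
apply: leq_trans (_ : 6 * (a * (c * p)) <= _)%N; last by rewrite leq_pmulr.
by rewrite -[(2 * a * _)%N]mulnA mulnDr muln1; lia.
Qed.

Lemma fwd_small l : (l <= k)%N -> (4 ^ l * fwd_error <= scale p m)%N.
Proof.
move=> lk; apply: leq_trans scale_big; have := expN 2 lk;
  have -> : (2 ^ 2 = 4)%N by [].
rewrite /fwd_error; have -> : (N ^ 12 = N ^ 2 * N ^ 5 * N ^ 5)%N by rewrite -!expnD.
have N5 : (0 < N ^ 5)%N by rewrite !expn_gt0.
have p0 := prime_gt0 p_pr.
move: (N ^ 2)%N (N ^ 5)%N (4 ^ l)%N N5 => a b c b0 ca.
have : (c * (p * b) <= a * (p * b))%N by rewrite leq_mul2r ca orbT.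
have : (a * (p * b) <= p ^ 2 * (a * b * b))%N.
  have -> : (p ^ 2 * (a * b * b) = a * (p * b) * (p * b))%N by rewrite expnS
    expn1; lia.
  by rewrite leq_pmulr // muln_gt0 p0.
lia.
Qed.

Lemma norm1_sum n (F : 'I_n -> R[i]) : norm1 (\sum_i F i) <= \sum_i norm1 (F i).
Proof.
apply: (big_ind2 (fun x y => norm1 x <= y)) => //.
  by rewrite /norm1 /= normr0 addr0.
by move=> x1 y1 x2 y2 h1 h2; apply: le_trans (norm1D _ _) (lerD h1 h2).
Qed.

Lemma convC_norm y j : (j < N)%N -> norm1 (convC y j) <= (N * p ^ 2)%N%:R.
Proof.
move=> jN; apply: le_trans (norm1_sum _) _.
apply: le_trans (_ : \sum_(x < j.+1) (p ^ 2)%:R <= _).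
  apply: ler_sum => x _; apply: le_trans (norm1M _ _) _.
  by rewrite natrX expr2; apply: ler_pM; rewrite ?norm1_ge0 ?rowC_norm.
rewrite sumr_const card_ord -[_ *+ j.+1]mulr_natl -natrM ler_nat.
by rewrite leq_mul2r jN orbT.
Qed.

Lemma rowC_row0 y j : (y < m)%N -> (m <= j)%N -> rowC y j = 0.
Proof. by move=> ym mj; rewrite /rowC /coef ym /coefF ltnNge mj. Qed.

Lemma rowC_ker0 j : (2 * m <= j)%N -> rowC m j = 0.
Proof. by move=> mj; rewrite /rowC /coef ltnn ltnNge mj. Qed.

Lemma fft_convC y i : (y < m)%N -> (i < N)%N ->
  fft k w (convC y) k i = fft k w (rowC y) k i * fft k w (rowC m) k i.
Proof.
move=> ym iN; apply: (fft_conv (@tw_sqr R k) (m1 := m) (m2 := 2 * m)) => //.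
- by have := sizeN_ge m; rewrite mulSn.
- by move=> j; exact: rowC_row0.
- exact: rowC_ker0.
Qed.

Lemma bwd_error_start :
  (2 + 4 ^ k * fwd_error * (4 ^ k * p + 1) + 4 ^ k * p * (4 ^ k * fwd_error) <=
   bwd_error)%N.
Proof.
have -> : (4 ^ k = N ^ 2)%N by rewrite /sizeN -expnM mulnC expnM.
have -> : (N ^ 2 * fwd_error = 6 * p * N ^ 7)%N.
  have -> : (N ^ 7 = N ^ 2 * N ^ 5)%N by rewrite -expnD.
  rewrite /fwd_error; move: (N ^ 2)%N (N ^ 5)%N => *; ring.
rewrite /bwd_error; have -> : (N ^ 9 = N ^ 7 * N ^ 2)%N by rewrite -expnD.
have N7 : (0 < N ^ 7)%N by rewrite !expn_gt0.
have p0 := prime_gt0 p_pr.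
have N2 : (0 < N ^ 2)%N by rewrite !expn_gt0.
move: (N ^ 7)%N (N ^ 2)%N N7 N2 => a b a0 b0.
have -> : (20 * p ^ 2 * (a * b) = 20 * (p * a * (p * b)))%N by ring.
have -> : (2 + 6 * p * a * (b * p + 1) + b * p * (6 * p * a) =
  2 + 6 * (p * a) + 12 * (p * a * (p * b)))%N by ring.
have : (p * a <= p * a * (p * b))%N by rewrite leq_pmulr // muln_gt0 p0.
have : (0 < p * a)%N by rewrite muln_gt0 p0.
lia.
Qed.

(** A difference doubles the error and the conjugate twiddle factor doubles it again; the fifth copy
    absorbs the twiddle error and the floors. *)
Lemma bwd_error_step l :
  (4 * (5 ^ l * bwd_error) + (2 * N ^ 3 * (2 * (N ^ 4 * p ^ 2) + 1) + 2) <=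
   5 ^ l.+1 * bwd_error)%N.
Proof.
have -> : (5 ^ l.+1 * bwd_error = 4 * (5 ^ l * bwd_error) + 5 ^ l * bwd_error)%N.
  by rewrite expnS; lia.
rewrite leq_add2l; apply: leq_trans (_ : bwd_error <= _)%N; last first.
  by rewrite leq_pmull // expn_gt0.
rewrite /bwd_error; have -> : (N ^ 9 = N ^ 3 * N ^ 4 * N ^ 2)%N by rewrite -!expnD.
have N3 : (0 < N ^ 3)%N by rewrite !expn_gt0.
have N4 : (0 < N ^ 4)%N by rewrite !expn_gt0.
have N2 : (0 < N ^ 2)%N by rewrite !expn_gt0.
have p0 : (0 < p ^ 2)%N by rewrite expn_gt0 prime_gt0.
move: (N ^ 3)%N (N ^ 4)%N (N ^ 2)%N (p ^ 2)%N N3 N4 N2 p0 => a b c d a0 b0 c0 d0.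
have -> : (20 * d * (a * b * c) = 20 * (a * (b * d)) * c)%N by ring.
apply: leq_trans (_ : 20 * (a * (b * d)) <= _)%N; last by rewrite leq_pmulr.
have : (a <= a * (b * d))%N by rewrite leq_pmulr // muln_gt0 b0.
have -> : (2 * a * (2 * (b * d) + 1) + 2 = 4 * (a * (b * d)) + 2 * a + 2)%N by ring.
lia.
Qed.

Lemma bwd_small l : (l <= k)%N -> (2 * (5 ^ l * bwd_error) < scale p m)%N.
Proof.
move=> lk; apply: leq_trans scale_big; rewrite /bwd_error.
have N12 : (N ^ 12 = N ^ 3 * N ^ 9)%N by rewrite -expnD.
have h : (5 ^ l <= N ^ 3)%N.
  by apply: leq_trans (expN 3 lk); case: l {lk} => // l; rewrite leq_exp2r.
have N9 : (0 < N ^ 9)%N by rewrite !expn_gt0.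
have N3 : (0 < N ^ 3)%N by rewrite !expn_gt0.
have p0 : (0 < p ^ 2)%N by rewrite expn_gt0 prime_gt0.
rewrite N12; move: (N ^ 3)%N (N ^ 9)%N (p ^ 2)%N (5 ^ l)%N N9 N3 p0 h => a b c d
  b0 a0 c0 da.
have -> : (2 * (d * (20 * c * b)) = 40 * (d * (c * b)))%N by ring.
have -> : (100 * (c * (a * b)) = 100 * (a * (c * b)))%N by ring.
have : (d * (c * b) <= a * (c * b))%N by rewrite leq_mul2r da orbT.
have : (0 < a * (c * b))%N by rewrite !muln_gt0 a0 c0.
lia.
Qed.

Lemma bwd_norm y l i : (l <= k)%N -> (i < N)%N ->
  norm1 ((2 ^ l)%:R * fft k w (convC y) (k - l) i) <= (N ^ 4 * p ^ 2)%N%:R.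
Proof.
move=> lk iN; apply: le_trans (norm1M _ _) _; rewrite norm1_nat.
have := fft_norm1 w_norm (convC_norm y) (leq_subr l k) iN.
rewrite -natrX -natrM => h; apply: le_trans (ler_wpM2l _ h) _ => //.
have e4 : (N ^ 4 * p ^ 2 = N * (N ^ 2 * (N * p ^ 2)))%N.
  by move: (p ^ 2)%N N => a b; ring.
rewrite -natrM ler_nat e4 leq_mul ?leq_exp2l // leq_mul2r.
by rewrite (expN 2 (leq_subr l k)) orbT.
Qed.

Definition convN (y j : nat) : nat :=
  \sum_(x < j.+1) `|coef m f y x|%N * `|coef m f m (j - x)|%N.

Lemma convCE y j : convC y j = (convN y j)%:Z%:~R.
Proof.
rewrite -[RHS]/((convN y j)%:R) natr_sum; apply: eq_bigr => x _.
by rewrite natrM.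
Qed.

(** Modulo [p] the integer convolution is the Lagrange sum: terms with [x >= m] vanish, and the
    other kernel indices [j - x] are below [2m] and [p], where the table holds true inverses. *)
Lemma conv_extrapolation y j : (size f <= m)%N -> (y < m)%N -> (m <= j < p)%N ->
  (j < 2 * m)%N ->
  (convN y j)%:R * (j`!)%:R * ((j - m)`!)%:R^-1 = (row_poly f y).[j%:R].
Proof.
move=> szf ym jm j2; rewrite (lagrange_extrapolation p_pr _ _ jm); last first.
- exact: leq_trans (size_poly _ _) szf.
- exact: ltnW.
rewrite -mulrA [LHS]mulrC; congr (_ * _); rewrite natr_sum.
case/andP: jm => mj jp.
rewrite (big_ord_widen _ (fun x => (row_poly f y).[x%:R] * (x`!)%:R^-1 *
   ((-1) ^+ (m.-1 - x) * ((m.-1 - x)`!)%:R^-1) * (j - x)%:R^-1) (leqW mj)).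
rewrite [RHS]big_mkcond; apply: eq_bigr => x _.
rewrite natrM /coef ym ltnn /phi !absz_nat !Fp_natK /coefF.
case: ifP => xm; last by rewrite mul0r.
have jx := leq_subr x j.
by rewrite (leq_ltn_trans jx j2) /ivF (leq_ltn_trans jx jp).
Qed.

Section State.
Variable st : state.
Variable t : nat.
Hypotheses (v0 : vars st 0 = m%:Z) (v1 : vars st 1 = p%:Z) (v2 : vars st 2 = t%:Z).
Hypothesis hpow : holds (arrs st) (pow_fact m).
Hypothesis hscale : holds (arrs st) (scale_fact p m).

Lemma ev_S : eval st xS = S.
Proof. by have [] := hscale (t := 13) isT. Qed.

Lemma ev_divS e : eval st (Bin Div e xS) = (eval st e %/ S)%Z.
Proof. by rewrite -ev_S. Qed.

Lemma ev_modP e : eval st (Bin Mod e xP) = (eval st e %% p)%Z.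
Proof. by rewrite -(ev_P v1). Qed.

Lemma tw_step : holds (arrs st) (top_fact m) -> (t < N)%N ->
  holds (arrs st) (Fact 12 13 t (fspec tw_fact)) ->
  fspec tw_fact t (eval st tw_e1) (eval st tw_e2).
Proof.
move=> htop tN h; rewrite /tw_e1 /tw_e2 !(ev_T0 v2).
have ge1 h' : 1 <= 8 ^+ h' :> R by rewrite exprn_ege1 // ler1n.
have eT := ev_T v2.
case: eqP => [->|/eqP t0].
  split=> [h' _|h' /esym /eqP]; last by rewrite expn_eq0.
  rewrite ev_S tw0; apply: (@close_weak _ _ 0); last by rewrite mulr_ge0 ?exprn_ge0.
  by apply: close_eq; rewrite mulr1.
rewrite !(ev_ite _ _ (ev_eq eT (ev_const _ 1))); case: eqP => [->|/eqP t1].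
  split=> [h' h1|h' /esym /eqP].
    rewrite ev_S; apply: (@close_weak _ _ 0); last by rewrite mulr_ge0 ?exprn_ge0.
    rewrite (@tw_pow2D R k 0 0) //; last first.
      by have := sizeN_ge8 m_gt1; rewrite /sizeN; case: (lgN m).
    rewrite tw0 mul1r; apply: close_eq; apply/eqP; rewrite eq_complex /=.
    by apply/andP; split; apply/eqP; rewrite /gauss /=; ring.
  rewrite -[X in _ == X](expn0 2) eqn_exp2l // => /eqP->; rewrite ev_S /= expr0.
  by rewrite !mulr0 !mulr1 !subrr normr0.
have t2 : (1 < t)%N by lia.
have [hh hhE] : exists hh, trunc_log 2 t = hh.+1.
  by exists (trunc_log 2 t).-1; rewrite prednK // trunc_log_gt0.
have /andP[tlo thi] := trunc_log_bounds (isT : 1 < 2)%N (ltnW t2).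
rewrite hhE in tlo thi.
have hk : (hh.+1 < k)%N.
  by rewrite -(@ltn_exp2l 2) //; apply: leq_ltn_trans tlo tN.
have etop : eval st tw_top = (2 ^ hh.+1)%N%:Z.
  rewrite (ev_get _ eT); have [] := htop _ tN => -> _.
  by rewrite (negPf t0) hhE.
have s_big h' : (h' <= k)%N -> 8 * 8 ^+ h' + 12 <= s.
  move=> h'k; rewrite -natrX -natrM -natrD ler_nat; apply: leq_trans scale_big.
  have := expN 3 h'k; have -> : (2 ^ 3 = 8)%N by [].
  have p2 := prime_gt0 p_pr; have N8 := sizeN_ge8 m_gt1.
  have -> : (N ^ 12 = N ^ 3 * N ^ 9)%N by rewrite -expnD.
  have : (0 < N ^ 9)%N by rewrite expn_gt0 (leq_trans _ N8).
  have : (0 < p ^ 2)%N by rewrite expn_gt0 p2.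
  have : (0 < N ^ 3)%N by rewrite expn_gt0 (leq_trans _ N8).
  move: (8 ^ h')%N (N ^ 3)%N (N ^ 9)%N (p ^ 2)%N => a b c d b0 d0 c0 ab.
  by have := leq_trans (leq_pmulr b c0) (leq_pmull (b * c) d0); lia.
(* As [2 ^ hh.+1 <= t], any such [h'] is at least [hh + 2]; this gap provides the factor 8 that one
   product may cost. *)
have mono h' : (t < 2 ^ h')%N -> 8 * 8 ^+ hh.+1 <= 8 ^+ h' :> R.
  move=> th'; rewrite -exprS ler_weXn2l ?ler1n //.
  by rewrite -(@ltn_exp2l 2) //; apply: leq_ltn_trans tlo th'.
rewrite !(ev_ite _ _ (ev_eq etop eT)); case: eqP => [tE|/eqP tne].
  have ehalf : eval st (Bin Div xT (Const 2)) = (2 ^ hh)%N%:Z.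
    by rewrite (ev_div eT (ev_const _ 2)) -tE expnS mulKn.
  have [] := h (2 ^ hh)%N; first by rewrite /= -tE ltn_exp2l.
  rewrite /= -!(ev_get _ ehalf) => _ /(_ hh erefl)[g12 g13].
  have [] := @half_angle_error R S S_gt0 _ _ _ _ g12 g13.
    by have := s_big hh (ltnW (ltnW hk)); rewrite -[S%:~R]/s; have := ge1 hh; lra.
  have -> : isqrt ((S * S + eval st (Get 12 (Bin Div xT (Const 2))) * S) %/ 2)%Z =
      eval st tw_cos.
    by rewrite /tw_cos {2}/eval -/(eval st) -/(eval st xS) ev_S.
  have -> : (eval st (Get 13 (Bin Div xT (Const 2))) * S %/ (2 * eval st
    tw_cos))%Z =
      eval st (Bin Div (Bin Mul (Get 13 (Bin Div xT (Const 2))) xS) (Bin Mul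
        (Const 2) tw_cos)).
    by rewrite [RHS]/eval -/(eval st) -/(eval st xS) ev_S.
  rewrite -[S%:~R]/s => b1 b2.
  have {}b1 : `|(eval st tw_cos)%:~R - s * (cos_sin R hh.+1).1| <= 2 * 8 ^+ hh.+1
    - 2.
    by apply: le_trans b1 _; rewrite exprS; have := ge1 hh; lra.
  have {}b2 : `|(eval st (Bin Div (Bin Mul (Get 13 (Bin Div xT (Const 2))) xS)
    (Bin Mul (Const 2) tw_cos)))%:~R
     - s * (cos_sin R hh.+1).2| <= 2 * 8 ^+ hh.+1 - 2.
    by apply: le_trans b2 _; rewrite exprS; have := ge1 hh; lra.
  split=> h' ht; last first.
    by move: ht => /eqP; rewrite -tE eqn_exp2l // => /eqP<-.
  have -> : w t = rho R hh.+1.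
    by rewrite -tE -[(2 ^ _)%N]addn0 tw_pow2D ?expn_gt0 // tw0 mul1r.
  apply: close_weak (close_rho b1 b2) _; have := mono _ ht; have := ge1 hh.+1; lra.
have blt : (t - 2 ^ hh.+1 < 2 ^ hh.+1)%N by rewrite expnS in thi; lia.
have ej : eval st (Bin Defs.Sub xT tw_top) = (t - 2 ^ hh.+1)%N%:Z by exact: ev_sub
  eT etop tlo.
have [] := h (t - 2 ^ hh.+1)%N; first by rewrite /=; have := expn_gt0 2 hh.+1; lia.
rewrite /= -!(ev_get _ ej) => /(_ _ blt) gb _.
have [] := h (2 ^ hh.+1)%N; first by rewrite /=; lia.
rewrite /= -!(ev_get _ etop) => _ /(_ _ erefl)[g1 g2].
have gr := close_rho g1 g2.
split=> h' ht; last first.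
  move: tlo thi; rewrite ht leq_exp2l // ltn_exp2l // => l1 l2.
  by case/eqP: tne; rewrite ht; congr (_ ^ _)%N; lia.
have wE : w t = w (t - 2 ^ hh.+1) * rho R hh.+1 by rewrite -tw_pow2D // subnKC.
have := closeM S_gt0 gb gr (w_norm _) (unitary_norm1 (rho_unitary _)).
have -> : ((eval st (Get 12 (Bin Defs.Sub xT tw_top)) * eval st (Get 12 tw_top) -
     eval st (Get 13 (Bin Defs.Sub xT tw_top)) * eval st (Get 13 tw_top)) %/ S)%Z =
  eval st (Bin Div (Bin Defs.Sub (Bin Mul (Get 12 (Bin Defs.Sub xT tw_top)) (Get
    12 tw_top))
      (Bin Mul (Get 13 (Bin Defs.Sub xT tw_top)) (Get 13 tw_top))) xS).
  by rewrite [RHS]/eval -/(eval st) -/(eval st xS) ev_S.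
have -> : ((eval st (Get 12 (Bin Defs.Sub xT tw_top)) * eval st (Get 13 tw_top) +
     eval st (Get 13 (Bin Defs.Sub xT tw_top)) * eval st (Get 12 tw_top)) %/ S)%Z =
  eval st (Bin Div (Bin Add (Bin Mul (Get 12 (Bin Defs.Sub xT tw_top)) (Get 13
    tw_top))
      (Bin Mul (Get 13 (Bin Defs.Sub xT tw_top)) (Get 12 tw_top))) xS).
  by rewrite [RHS]/eval -/(eval st) -/(eval st xS) ev_S.
rewrite -wE => /(_ _)/close_weak; apply.
  by have := s_big hh.+1 (ltnW hk); rewrite -[S%:~R]/s; have := ge1 hh.+1; lra.
have := mono _ ht; have := ge1 hh.+1; lra.
Qed.

Let eN := ev_N p_pr m_gt1 m_le_p v0 v1 hpow.
Let eK := ev_K p_pr m_gt1 m_le_p v0 v1 hpow.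
Let eT := ev_T v2.
Let eK1 : eval st (Bin Add xK (Const 1)) = (k + 1)%N%:Z.
Proof. exact: ev_add eK _. Qed.

Let e_y : eval st fft_y = (row t)%:Z.
Proof. exact: ev_div (ev_div eT eN) eK1. Qed.
Let e_l : eval st fft_l = (level t)%:Z.
Proof. exact: ev_mod (ev_div eT eN) eK1. Qed.
Let e_i : eval st fft_i = (pos t)%:Z.
Proof. exact: ev_mod eT eN. Qed.

Lemma ev_last e y : eval st e = y%:Z ->
  eval st (last_level e) = ((y * (k + 1) + k) * N + pos t)%N%:Z.
Proof. by move=> ey; exact: ev_add (ev_mul (ev_add (ev_mul ey eK1) eK) eN) e_i. Qed.

Section Halves.
Variables (eH : expr) (H l : nat).
Hypotheses (eHE : eval st eH = H%:Z) (lt : level t = l.+1) (H0 : (0 < H)%N).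
Hypothesis HN : exists n, N = (n * (2 * H))%N.

Local Notation lo := (lower H (pos t)).
Local Notation cell i := ((row t * (k + 1) + l) * N + i)%N.

Lemma ev_odd : eval st (fft_odd eH) = (odd (pos t %/ H))%:Z.
Proof. by rewrite (ev_mod (ev_div e_i eHE) (ev_const _ 2)) modn2. Qed.

Lemma ev_b : eval st (fft_b eH) = (pos t %/ (2 * H))%N%:Z.
Proof. exact: ev_div e_i (ev_mul (ev_const _ 2) eHE). Qed.

Lemma odd_block_le i : (odd (i %/ H) * H <= i)%N.
Proof. by have [r [_ e _]] := block_decomp i H0;
  rewrite [leqRHS]e addnAC leq_addl. Qed.

Lemma lo_lt : (lo < N)%N.
Proof. exact: leq_ltn_trans (lower_leq _ _) (pos_lt _). Qed.

Lemma hi_lt : (lo + H < N)%N.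
Proof. by have [n nE] := HN; rewrite nE upper_lt // -nE pos_lt. Qed.

Lemma cell_prev : (cell (pos t) + N = t)%N.
Proof. by rewrite [RHS]cell_eq lt -[l.+1]addn1 addnA [in RHS]mulnDl mul1n addnAC.
  Qed.

Lemma ev_lo : eval st (fft_lo eH) = (cell lo)%:Z.
Proof.
have h1 := odd_block_le (pos t); have h2 := cell_prev.
have Nt : (N <= t)%N by rewrite -[X in (_ <= X)%N]h2 leq_addl.
have tN : (t - N = cell (pos t))%N by rewrite -{1}h2 addnK.
have le : (odd (pos t %/ H) * H <= cell (pos t))%N by exact: leq_trans h1
  (leq_addl _ _).
rewrite (ev_sub (ev_sub eT eN Nt) (ev_mul ev_odd eHE)) tN //.
by rewrite /lower addnBA.
Qed.

Lemma ev_hi : eval st (fft_hi eH) = (cell (lo + H))%:Z.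
Proof. by rewrite addnA; exact: ev_add ev_lo eHE. Qed.

Lemma cell_lt i : (i < N)%N -> (cell i < t)%N.
Proof. by move=> iN; rewrite -[X in (_ < X)%N]cell_prev -addnA ltn_add2l ltn_addl.
  Qed.

Lemma block_lt : (pos t %/ (2 * H) < N)%N.
Proof. exact: leq_ltn_trans (leq_div _ _) (pos_lt _). Qed.

End Halves.

Lemma tw_close b : holds (arrs st) tw_fact -> (b < N)%N ->
  approx (2 * N ^ 3)%N%:R (arrs st 12 b%:Z) (arrs st 13 b%:Z) (w b).
Proof.
move=> htw bN; have [/(_ k bN) h _] := htw _ bN.
by apply: close_weak h _; rewrite -natrX -natrM ler_nat /sizeN -expnM [(k *
  3)%N]mulnC expnM.
Qed.

Lemma fwd_step : holds (arrs st) tw_fact -> holds (arrs st) (coef_fact m f) ->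
  (t < (m + 1) * (k + 1) * N)%N ->
  holds (arrs st) (Fact 16 17 t (fspec fwd_fact)) ->
  fspec fwd_fact t (eval st fwd_e1) (eval st fwd_e2).
Proof.
move=> htw hco tm h; rewrite /fwd_e1 /fwd_e2 !(ev_ite _ _ (ev_eq e_l (ev_const _
  0))).
rewrite /=; have lk := level_le t; case: eqP => [l0|/eqP l0].
  have ei := ev_add (ev_mul e_y eN) e_i.
  have ylt : (row t < m + 1)%N.
    rewrite ltn_divLR; last by rewrite addn1.
    by rewrite ltn_divLR // /sizeN expn_gt0.
  have clt : (row t * N + pos t < (m + 1) * N)%N.
    by have := pos_lt t; move: (row t) (pos t) ylt => a b *; nia.
  have [] := hco _ clt; rewrite -!(ev_get _ ei) => g _.
  rewrite l0 /=; apply: (@close_weak _ _ 0) => //.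
  have -> : eval st (Bin Mul (Get 14 (Bin Add (Bin Mul fft_y xN) fft_i)) xS) =
      coef m f (row t) (pos t) * S.
    rewrite -[LHS]/(eval st (Get 14 (Bin Add (Bin Mul fft_y xN) fft_i)) * eval st
      xS) g ev_S.
    by rewrite divnMDl ?(divn_small (pos_lt t)) ?addn0 ?modnMDl ?(modn_small
      (pos_lt t)) // /sizeN expn_gt0.
  exact: close_gauss.
have [l lE] : exists l, level t = l.+1 by exists (level t).-1;
  rewrite prednK // lt0n.
have eH : eval st fwd_H = (2 ^ (k - l.+1))%N%:Z.
  by apply: (ev_pow2 p_pr m_gt1 m_le_p v0 v1 hpow); [rewrite -lE;
    apply: ev_sub eK e_l lk | exact: leq_subr].
set H := (2 ^ (k - l.+1))%N in eH; have H0 : (0 < H)%N by rewrite expn_gt0.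
have lk' : (l < k)%N by rewrite -lE.
have HN : exists n, N = (n * (2 * H))%N.
  by exists (2 ^ l)%N; rewrite /H -expnS -expnD /sizeN; congr (_ ^ _)%N; lia.
have elo := ev_lo eH lE H0; have ehi := ev_hi eH lE H0; have eb := ev_b eH.
have := h _ (cell_lt lE (lo_lt H)); rewrite -!(ev_get _ elo) /=.
have [-> -> ->] := cellP (row t) (ltnW lk') (lo_lt H) => glo.
have := h _ (cell_lt lE (hi_lt H0 HN)); rewrite -!(ev_get _ ehi) /=.
have [-> -> ->] := cellP (row t) (ltnW lk') (hi_lt H0 HN) => ghi.
have := tw_close htw (block_lt H); rewrite -!(ev_get _ eb) => gw.
have hnorm := fft_norm1 w_norm (fun j _ => rowC_norm (row t) j) (ltnW lk') (hi_lt
  H0 HN).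
have := closeM S_gt0 gw ghi (w_norm _) hnorm.
rewrite -[S%:~R]/s => /(_ (natr_le (fwd_small (ltnW lk')))) gp.
rewrite lE /= -/H.
have sgnE : eval st fwd_sgn = (-1) ^+ odd (pos t %/ H).
  rewrite -[LHS]/(1 - 2 * eval st (fft_odd fwd_H)) (ev_odd eH).
  by case: odd.
set x1 := eval st (Bin Add _ _); set x2 := eval st (Bin Add _ _).
have -> : x1 = eval st (Get 16 (fft_lo fwd_H)) + (-1) ^+ odd (pos t %/ H) *
   ((eval st (Get 12 (fft_b fwd_H)) * eval st (Get 16 (fft_hi fwd_H)) -
     eval st (Get 13 (fft_b fwd_H)) * eval st (Get 17 (fft_hi fwd_H))) %/ S)%Z.
  by rewrite -sgnE -ev_S.
have -> : x2 = eval st (Get 17 (fft_lo fwd_H)) + (-1) ^+ odd (pos t %/ H) *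
   ((eval st (Get 12 (fft_b fwd_H)) * eval st (Get 17 (fft_hi fwd_H)) +
     eval st (Get 13 (fft_b fwd_H)) * eval st (Get 16 (fft_hi fwd_H))) %/ S)%Z.
  by rewrite -sgnE -ev_S.
apply: (@close_weak _ _ ((4 ^ l * fwd_error)%N%:R + (2 + (2 * N ^ 3)%:R * (4 ^+ l
  * p%:R + 1) +
            2 * (4 ^ l * fwd_error)%N%:R))).
  by case: odd; rewrite ?expr0 ?expr1 ?mul1r ?mulN1r;
    [apply: closeB | apply: closeD].
have := natr_le (fwd_error_step (ltnW lk')); rewrite !(natrD, natrM, natrX); lra.
Qed.

Lemma bwd_step : holds (arrs st) tw_fact -> holds (arrs st) fwd_fact ->
  (t < m * (k + 1) * N)%N ->
  holds (arrs st) (Fact 18 19 t (fspec bwd_fact)) ->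
  fspec bwd_fact t (eval st bwd_e1) (eval st bwd_e2).
Proof.
move=> htw hfwd tm h; rewrite /bwd_e1 /bwd_e2 !(ev_ite _ _ (ev_eq e_l (ev_const _
  0))).
have ylt : (row t < m)%N.
  rewrite ltn_divLR; last by rewrite addn1.
  by rewrite ltn_divLR // /sizeN expn_gt0.
have last_lt y : (y <= m)%N ->
    ((y * (k + 1) + k) * N + pos t < (m + 1) * (k + 1) * N)%N.
  move=> ym; apply: leq_trans (_ : y.+1 * (k + 1) * N <= _)%N; last first.
    by rewrite !leq_mul2r [(m + 1)%N]addn1 ltnS ym !orbT.
  have -> : (y.+1 * (k + 1) = (y * (k + 1) + k).+1)%N by rewrite mulSn; lia.
  by rewrite mulSn addnC ltn_add2r pos_lt.
rewrite /=; have lk := level_le t; case: eqP => [l0|/eqP l0].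
  have eU := ev_last e_y; have eV := ev_last (ev_M v0).
  have := hfwd _ (last_lt _ (ltnW ylt)); rewrite -!(ev_get _ eU) /=.
  have [-> -> ->] := cellP (row t) (leqnn k) (pos_lt t) => gU.
  have := hfwd _ (last_lt _ (leqnn m)); rewrite -!(ev_get _ eV) /=.
  have [-> -> ->] := cellP m (leqnn k) (pos_lt t) => gV.
  have nU := fft_norm1 w_norm (fun j _ => rowC_norm (row t) j) (leqnn k) (pos_lt t).
  have nV := fft_norm1 w_norm (fun j _ => rowC_norm m j) (leqnn k) (pos_lt t).
  have := closeM S_gt0 gU gV nU nV.
  rewrite -[S%:~R]/s => /(_ (natr_le (fwd_small (leqnn k)))).
  rewrite l0 subn0 expn0 !mul1r mul1n fft_convC ?pos_lt // !ev_divS.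
  move=> g; apply: close_weak g _.
  have := natr_le bwd_error_start; rewrite !(natrD, natrM, natrX); lra.
have [l lE] : exists l, level t = l.+1 by exists (level t).-1;
  rewrite prednK // lt0n.
have lk' : (l < k)%N by rewrite -lE.
have eH : eval st bwd_H = (2 ^ l)%N%:Z.
  apply: (ev_pow2 p_pr m_gt1 m_le_p v0 v1 hpow); last exact: ltnW.
  by rewrite (ev_sub e_l (ev_const _ 1)) lE // subn1.
pose L := (k - l.+1)%N.
have kl : (k - l = L.+1)%N by rewrite /L; lia.
have kL : (k - L.+1 = l)%N by rewrite /L; lia.
set H := (2 ^ l)%N in eH; have H0 : (0 < H)%N by rewrite expn_gt0.
have HN : exists n, N = (n * (2 * H))%N.
  by exists (2 ^ L)%N; rewrite /H /L -expnS -expnD /sizeN; congr (_ ^ _)%N; lia.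
have elo := ev_lo eH lE H0; have ehi := ev_hi eH lE H0; have eb := ev_b eH.
have := h _ (cell_lt lE (lo_lt H)); rewrite -!(ev_get _ elo) /=.
have [-> -> ->] := cellP (row t) (ltnW lk') (lo_lt H) => glo.
have := h _ (cell_lt lE (hi_lt H0 HN)); rewrite -!(ev_get _ ehi) /=.
have [-> -> ->] := cellP (row t) (ltnW lk') (hi_lt H0 HN) => ghi.
have nlo := bwd_norm (row t) (ltnW lk') (lo_lt H).
have nhi := bwd_norm (row t) (ltnW lk') (hi_lt H0 HN).
rewrite lE -/L.
have dbl := fft_double k w (convC (row t)) L (pos t).
have twi := fft_twist k w (convC (row t)) L (pos t).
rewrite kL -/H in dbl twi; rewrite kl in glo ghi nlo nhi.
have errS := natr_le (bwd_error_step l).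
rewrite !(ev_ite _ _ (ev_eq (ev_odd eH) (ev_const _ 0))).
case o: (odd (pos t %/ H)) => /=.
  have gd := closeB glo ghi.
  have nd : norm1 ((2 ^ l)%:R * fft k w (convC (row t)) L.+1 (lower H (pos t)) -
      (2 ^ l)%:R * fft k w (convC (row t)) L.+1 (lower H (pos t) + H)) <=
      2 * (N ^ 4 * p ^ 2)%N%:R.
    by apply: le_trans (norm1D _ _) _; rewrite norm1N; lra.
  have gw := close_conj (tw_close htw (block_lt H)).
  rewrite -!(ev_get _ eb) in gw.
  have wn : norm1 (conj1 (w (pos t %/ (2 * H)))) <= 2 by rewrite norm1_conj w_norm.
  have := closeM S_gt0 gw gd wn nd; rewrite -[S%:~R]/s -mulr2n -natrM.
  rewrite -[(5 ^ l * bwd_error)%N%:R *+ 2]mulr_natl -natrM.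
  move=> /(_ (natr_le (ltnW (bwd_small (ltnW lk'))))).
  rewrite -mulrBr -twi (upper_eq H0 o).
  (* By [fft_twist] the difference is the upper input, doubled and multiplied by a unitary twiddle
     factor, which its conjugate cancels. *)
  rewrite (_ : conj1 _ * (_ * _) = (2 ^ l.+1)%:R * fft k w (convC (row t)) L (pos
    t)); last first.
    have cw := unitary_conj (tw_unitary R k (pos t %/ (2 * H))).
    rewrite [(2 ^ _.+1)%N]expnS natrM -[RHS]mulr1 -[X in _ = _ * X]cw; ring.
  rewrite -[X in ((_ * _ - X * _) %/ _)%Z]sub0r -[X in ((_ * _ + X * _) %/
    _)%Z]sub0r.
  rewrite !ev_divS => g; apply: close_weak g _.
  move: errS; rewrite !(natrD, natrM, natrX); lra.
have gs := closeD glo ghi; rewrite -mulrDr -dbl lower_eq ?o // in gs.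
rewrite (_ : _ * (_ *+ 2) = (2 ^ l.+1)%:R * fft k w (convC (row t)) L (pos t)) in
  gs; last first.
  by rewrite expnS natrM; ring.
apply: close_weak gs _.
rewrite -natrD ler_nat; apply: leq_trans (bwd_error_step l).
by rewrite addnn -mul2n (leq_trans _ (leq_addr _ _)) // leq_mul2r orbT.
Qed.

Lemma val_step : (size f <= m)%N -> holds (arrs st) (in_fact m f) ->
  holds (arrs st) (inv_fact p m) -> holds (arrs st) (ifact_fact p m) ->
  holds (arrs st) bwd_fact -> (t < 2 * m * m)%N ->
  fspec val_fact t (eval st val_e1) (eval st (Const 0)).
Proof.
move=> szf hin hinv hif hbwd tm.
have m0 : (0 < m)%N by exact: ltnW.
have ej : eval st val_j = (t %/ m)%N%:Z by exact: ev_div eT (ev_M v0).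
have ey : eval st val_y = (t %% m)%N%:Z by exact: ev_mod eT (ev_M v0).
have ym : (t %% m < m)%N by rewrite ltn_pmod.
have j2 : (t %/ m < 2 * m)%N by rewrite ltn_divLR.
rewrite /val_e1 (ev_ite _ _ (ev_lt ej (ev_M v0))) /=.
case: (ltnP (t %/ m) m) => jm.
  have tmm : (t < m * m)%N by rewrite -ltn_divLR.
  have := hin _ tmm; rewrite -(ev_get _ eT) => -> /=.
  by split; [exists (nat_of_ord (row_poly f (t %% m)).[(t %/ m)%:R]) => //;
    exact: Fp_lt | split].
split.
  rewrite ev_modP; set z := eval st _.
  have p0 : 0 < p%:Z by have := prime_gt0 p_pr; lia.
  have := modz_ge0 z (lt0r_neq0 p0); have := ltz_pmod z p0.
  by case: (z %% p)%Z => // n np _; exists n.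
split=> // jp.
have ec := ev_add (ev_mul (ev_add (ev_mul ey eK1) eK) eN) ej.
have jN : (t %/ m < N)%N by apply: leq_trans j2 _; have := sizeN_ge m; lia.
have clt : ((t %% m * (k + 1) + k) * N + t %/ m < m * (k + 1) * N)%N.
  apply: leq_trans (_ : (t %% m).+1 * (k + 1) * N <= _)%N; last first.
    by rewrite !leq_mul2r ym !orbT.
  have -> : ((t %% m).+1 * (k + 1) = (t %% m * (k + 1) + k).+1)%N by rewrite
    mulSn; lia.
  by rewrite mulSn addnC ltn_add2r.
have := hbwd _ clt; rewrite -!(ev_get _ ec) /=.
have [-> -> ->] := cellP (t %% m) (leqnn k) jN.
rewrite subnn /= convCE => g.
(* The factor [2 ^ k] collected by the backward levels is the [n] of [close_round]. *)
have rE := close_round S_gt0 g (_ : (0 < 2 ^ k)%N) (_ : _ < _).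
set gt := eval st (Get 18 _) in rE.
have {}rE : eval st (Bin Div (Bin Add (Bin Mul (Const 2) (Get 18 (Bin Add (Bin Mul
    (Bin Add (Bin Mul val_y (Bin Add xK (Const 1))) xK) xN) val_j))) (Bin Mul xS
      xN))
    (Bin Mul (Const 2) (Bin Mul xS xN))) = (convN (t %% m) (t %/ m))%:Z.
  rewrite -rE ?expn_gt0 //.
    by rewrite -[LHS]/((2 * gt + eval st xS * eval st xN) %/ (2 * (eval st xS *
      eval st xN)))%Z eN ev_S.
  rewrite -[S%:~R]/s -natrM -natrM ltr_nat.
  apply: leq_trans (bwd_small (leqnn k)) _.
  by rewrite leq_pmulr // expn_gt0.
have [] := hinv _ j2; rewrite /= -!(ev_get _ ej) => _ g7.
have [] := hif (t %/ m - m)%N; first by rewrite /=; lia.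
rewrite /= -!(ev_get _ (ev_sub ej (ev_M v0) jm)) => g8 _.
rewrite (ev_mod (ev_mul (ev_mul rE g7) g8) (ev_P v1)) -modz_nat (modz_phi p_pr).
by rewrite !natrM !Fp_natK conv_extrapolation // jm.
Qed.

Lemma sum_step : holds (arrs st) val_fact -> (t < 2 * m * m)%N ->
  holds (arrs st) (Fact 22 23 t (fspec sum_fact)) ->
  fspec sum_fact t (eval st sum_e1) (eval st (Const 0)).
Proof.
move=> hval tm h.
have m0 : (0 < m)%N by exact: ltnW.
have ey : eval st val_y = (t %% m)%N%:Z by exact: ev_mod eT (ev_M v0).
have [[u uE up] [uV _]] := hval _ tm; rewrite /= -(ev_get _ eT) in uE uV.
have [q qE qV] : exists2 q : nat,
    eval st (xite (xeq val_y (Const 0)) (Const 0) (Get 22 (Bin Defs.Sub xT (Const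
      1)))) = q%:Z &
    ((t %/ m < p)%N -> q%:R = \sum_(0 <= y < t %% m) (row_poly f y).[(t %/ m)%:R]
      ^+ 2 :> 'F_p).
  rewrite (ev_ite _ _ (ev_eq ey (ev_const _ 0))); case: eqP => [->|/eqP y0].
    by exists 0%N => // _; rewrite big_nil.
  have t0 : (0 < t)%N by case: (t) y0 => //; rewrite mod0n.
  have [] := h t.-1; first by rewrite /= prednK.
  rewrite /= -(ev_get _ (ev_pred v2 t0)) => -[q -> qp] [qV _].
  have tE : t.-1 = (t %/ m * m + (t %% m).-1)%N.
    by rewrite {1}(divn_eq t m) -!subn1 addnBA // lt0n.
  have ylt : ((t %% m).-1 < m)%N by apply: leq_ltn_trans (leq_pred _) _;
    rewrite ltn_pmod.
  rewrite tE divnMDl // (divn_small ylt) addn0 modnMDl (modn_small ylt) prednK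
    ?lt0n // in qV.
  exists q => // jp; have := qV jp; rewrite /phi => -[->].
  exact: Fp_natK.
have e := ev_mod (ev_add qE (ev_mul uE uE)) (ev_P v1).
rewrite /sum_e1 e /=; split; first by eexists;
  [by [] | rewrite ltn_pmod // prime_gt0].
split=> // jp; rewrite -modz_nat (modz_phi p_pr) natrD natrM (qV jp) big_nat_recr
  //=.
have /= := uV jp; rewrite uE /phi => -[->]; rewrite Fp_natK -expr2; congr phi.
Qed.

Lemma out_step : holds (arrs st) sum_fact -> (t < 2 * m)%N ->
  fspec out_fact t (eval st out_e1) (eval st (Const 0)).
Proof.
move=> hsum tm; split=> //.
have p0 := prime_gt0 p_pr; have m0 : (0 < m)%N by exact: ltnW.
have e := ev_add (ev_mul (ev_mod eT (ev_P v1)) (ev_M v0)) (ev_sub (ev_M v0)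
  (ev_const _ 1) m0).
rewrite /out_e1 (ev_get _ e); have m1 : (m - 1 < m)%N by rewrite ltn_subrL m0.
have tp : (t %% p < 2 * m)%N by exact: leq_ltn_trans (leq_mod _ _) tm.
have [] := hsum (t %% p * m + (m - 1))%N.
  apply: leq_trans (_ : (t %% p).+1 * m <= _)%N; last by rewrite leq_mul2r tp orbT.
  by rewrite mulSn addnC ltn_add2r.
rewrite /= divnMDl // (divn_small m1) addn0 modnMDl (modn_small m1) subn1 prednK //.
move=> _ [-> //]; last by rewrite ltn_pmod.
by rewrite honest_polyE (natr_Fp_mod p_pr).
Qed.

End State.
End Approx.

(** * The whole run *)

Lemma input_entry p m (a : 'M['F_p]_m) (x y : 'I_m) :
  arrs (input_state a) 0 (x * m + y)%N%:Z = (a x y : nat)%:Z.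
Proof.
have key (x' y' : 'I_m) :
    ((x * m + y)%N%:Z == (x' * m + y')%N%:Z) = (x' == x) && (y' == y).
  rewrite eqz_nat; apply/eqP/andP => [e|[/eqP-> /eqP->] //].
  have m0 : (0 < m)%N by exact: leq_ltn_trans (ltn_ord x).
  have := congr1 (divn^~ m) e; have := congr1 (modn^~ m) e => /=.
  rewrite !modnMDl !modn_small // !divnMDl // !divn_small // !addn0 => e1 e2.
  by split; apply/eqP/val_inj.
rewrite /= (bigD1 x) //= [X in _ + X]big1 ?addr0 => [|x' x'x].
  by rewrite (big_pred1 y) // => y'; rewrite /= key eqxx.
by rewrite big1 // => y'; rewrite key (negPf x'x).
Qed.

Lemma input_entry_bound p m (a : 'M['F_p]_m) b (i : int) :
  prime p -> (`|arrs (input_state a) b i| < p)%N.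
Proof.
move=> p_pr; have p0 := prime_gt0 p_pr; case: b => [|b] //.
case: (boolP [exists x : 'I_m, exists y : 'I_m, i == (x * m + y)%N%:Z]).
  move=> /existsP[x /existsP[y /eqP->]]; rewrite input_entry; exact: Fp_lt.
move=> /existsPn h; rewrite /= big1 // => x _; rewrite big1 // => y iE.
by have := h x; rewrite negb_exists => /forallP/(_ y); rewrite iE.
Qed.

Definition run (W : nat) (c : cmd) (st : state) (T : nat) (Q : state -> Prop) :=
  exists t st', [/\ exec W c st t st', (t <= T)%N & Q st'].

Section Run.
Variables (p m : nat) (a : 'M['F_p]_m) (f : {poly {poly 'F_p}}) (W : nat).
Hypotheses (p_pr : prime p) (m_gt1 : (1 < m)%N) (m_le_p : (m <= p)%N).
Hypothesis fP : interpolates a f.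
Local Notation k := (lgN m).
Local Notation N := (sizeN m).
Local Notation R := realalg.

(** The exponent is 13 + 4 + 3: the scale, the largest transform value [N^4 p^2], and room for the
    error terms. *)
Definition mem_bound : nat := (N * p) ^ 20.
(** Exceeds the length of every loop; the longest one fills the [(m + 1) * (k + 1) * N] cells of the
    forward transforms. *)
Definition time_unit : nat := 20 * (m + 1) * (k + 1) * N.
Hypothesis BW : (mem_bound ^ degree_bound < 2 ^ W)%N.
Local Notation B := mem_bound.

Lemma Np_ge16 : (16 <= N * p)%N.
Proof. by have := sizeN_ge8 m_gt1; have := prime_gt1 p_pr; nia. Qed.

Lemma mem_bound_ge : (N * p <= B)%N.
Proof. by rewrite -{1}[(N * p)%N]expn1 leq_exp2l //; have := Np_ge16; lia. Qed.

Lemma mem_bound16 : (16 <= B)%N.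
Proof. exact: leq_trans Np_ge16 mem_bound_ge. Qed.

Lemma p_le_bound : (p <= B)%N.
Proof.
apply: leq_trans mem_bound_ge; rewrite leq_pmull //.
by apply: leq_trans (sizeN_ge8 m_gt1).
Qed.

Lemma N_le_bound : (N <= B)%N.
Proof. by apply: leq_trans mem_bound_ge; rewrite leq_pmulr // prime_gt0. Qed.

Lemma phi_bound (u : 'F_p) : (`|phi u| <= B)%N.
Proof. exact: leq_trans (ltnW (phi_lt p_pr u)) p_le_bound. Qed.

Lemma scale_bound : (scale p m * (N ^ 4 * p ^ 2) + scale p m <= B)%N.
Proof.
have q16 := Np_ge16; have p0 := prime_gt0 p_pr.
have -> : B = ((N * p) ^ 13 * ((N * p) ^ 4 * (N * p) ^ 3))%N.
  by rewrite /mem_bound -!expnD.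
rewrite /scale -[X in (_ + X <= _)%N]muln1 -mulnDr leq_mul2l; apply/orP; right.
have h1 : (N ^ 4 * p ^ 2 <= (N * p) ^ 4)%N.
  by rewrite expnMn leq_mul2l leq_pexp2l ?orbT.
have h2 : (2 <= (N * p) ^ 3)%N.
  by apply: leq_trans (_ : N * p <= _)%N;
    [lia | rewrite -{1}[(N * p)%N]expn1 leq_exp2l //; lia].
have : (0 < N ^ 4 * p ^ 2)%N by rewrite muln_gt0 !expn_gt0 p0.
move: (N ^ 4 * p ^ 2)%N ((N * p) ^ 4)%N ((N * p) ^ 3)%N h1 h2 => x y z xy z2 x0.
by apply: leq_trans (leq_mul (leqnn y) z2); lia.
Qed.

Lemma close_bounded (e : R) v1 v2 x (M : nat) :
  @close R (scale p m)%:Z e v1 v2 x -> e <= (scale p m)%:R ->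
  norm1 x <= M%:R -> (M <= N ^ 4 * p ^ 2)%N ->
  (`|v1| <= B)%N /\ (`|v2| <= B)%N.
Proof.
move=> h es xM MN; apply: (close_bound (S_gt0 p_pr m_gt1 m_le_p) h).
rewrite -[_%:~R]/((scale p m)%:R).
apply: le_trans (natr_le R scale_bound); rewrite natrD natrM; apply: lerD => //.
by rewrite ler_wpM2l // (le_trans xM) // ler_nat.
Qed.

Lemma len_bound n : (n <= (m + 1) * (k + 1) * N)%N -> (n < B)%N.
Proof.
move=> /leq_ltn_trans; apply; apply: leq_trans (_ : N ^ 3 * p ^ 3 <= _)%N;
  last first.
  by rewrite -expnMn leq_exp2l //; have := Np_ge16; lia.
have mN : (m + 1 <= N)%N by have := sizeN_ge m; lia.
have kN : (k + 1 <= N)%N by rewrite addn1 lgN_lt.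
have p1 : (1 < p ^ 3)%N by rewrite -(exp1n 3) ltn_exp2r // prime_gt1.
have N0 : (0 < N ^ 3)%N by rewrite !expn_gt0.
apply: leq_ltn_trans (_ : N ^ 3 < _)%N;
  last by rewrite -{1}[(N ^ 3)%N]muln1 ltn_mul2l N0.
by rewrite !expnS expn0 muln1 mulnA !leq_mul.
Qed.

(** The rest of the program appears as a continuation, so that loops are chained by repeated
    application while the list of facts grows. *)
Lemma run_phase (L : seq fact) (F : fact) bd e1 e2 c c' st Q :
  [&& (2 < degree_bound)%N, fa F != fb F, fresh (fa F) L, fresh (fb F) L, no_var 3
    e1,
      tame degree_bound bd, tame degree_bound e1, tame degree_bound e2 &
      tame degree_bound (phase_guard bd)] ->
  (flen F < B)%N -> (flen F < time_unit)%N ->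
  (forall st, knows B m p L st -> eval st bd = (flen F)%:Z) ->
  (forall t v1 v2, (t < flen F)%N -> fspec F t v1 v2 ->
     (`|v1| <= B)%N /\ (`|v2| <= B)%N) ->
  (forall (t : nat) st, (t < flen F)%N -> knows B m p L st -> vars st 2 = t%:Z ->
     holds (arrs st) (Fact (fa F) (fb F) t (fspec F)) ->
     fspec F t (eval st e1) (eval st e2)) ->
  (forall st', knows B m p (F :: L) st' -> run W c st' (c' * time_unit) Q) ->
  knows B m p L st ->
  run W (Seq (phase (fa F) (fb F) bd e1 e2) c) st
    ((phase_cost bd e1 e2 + c') * time_unit) Q.
Proof.
move=> ok lB lT bdE bnd step next kst.
have [t [st1 [ex1 le1 k1]]] := phase_exec mem_bound16 BW ok lB bdE bnd step kst.
have [t2 [st2 [ex2 le2 q2]]] := next _ k1.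
exists (t + t2)%N, st2; split=> //; first exact: exec_seq ex1 ex2.
by rewrite mulnDl leq_add // (leq_trans le1) // leq_mul2l lT orbT.
Qed.

Lemma input_knows : knows B m p [:: in_fact m f] (input_state a).
Proof.
have mp := leq_trans m_le_p p_le_bound.
split=> //.
  split=> [z|b i]; last exact: leq_trans (ltnW (input_entry_bound _ _ _ p_pr))
    p_le_bound.
  by rewrite /=; case: ifP => // _; case: ifP => // _; exact: p_le_bound.
split=> // t /= tm; have m0 : (0 < m)%N by exact: ltnW.
have xm : (t %/ m < m)%N by rewrite ltn_divLR.
have ym : (t %% m < m)%N by rewrite ltn_pmod.
have := input_entry a (Ordinal xm) (Ordinal ym); rewrite /= -divn_eq => ->.
by have [_ _ /(_ (Ordinal xm) (Ordinal ym)) <-] := fP; rewrite row_polyE.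
Qed.

Lemma prover_run : run W prover (input_state a) (prover_cost * time_unit)
  (fun st => holds (arrs st) (out_fact m f)).
Proof.
have m0 : (0 < m)%N by exact: ltnW.
have N0 : (0 < N)%N by rewrite expn_gt0.
have N8 := sizeN_ge8 m_gt1.
have [szf _ _] := fP.
have mN := sizeN_ge m.
have kN := lgN_lt m.
pose U := ((m + 1) * (k + 1) * N)%N.
have U1 : ((m + 1) * N <= U)%N by rewrite leq_mul2r leq_pmulr ?orbT // addn1.
have lenT n : (n <= 14 * U -> n < time_unit)%N.
  have -> : time_unit = (20 * U)%N by rewrite /time_unit /U !mulnA.
  by have : (0 < U)%N by [apply: leq_trans U1; rewrite muln_gt0 addn1]; lia.
have mm : (2 * m * m <= U)%N by apply: leq_trans U1; nia.
have NU : (N <= U)%N by apply: leq_trans U1; rewrite leq_pmull // addn1.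
have hm : (m + 1 <= U)%N by apply: leq_trans U1; rewrite leq_pmulr.
have U14 : (14 <= U)%N.
  by apply: leq_trans U1; apply: leq_trans (_ : 2 * 8 <= _)%N => //;
    apply: leq_mul => //; lia.
rewrite /prover /prover_cost /phases /=.
apply: (run_phase (F := pow_fact m)) input_knows => [||||||st1 k1].
- by vm_compute.
- by apply: len_bound; rewrite /= -/U; nia.
- by apply: lenT; rewrite /=; lia.
- by move=> st [v0 _ _ _]; exact: ev_add (ev_3M v0) _.
- move=> t v1 v2 _ /= [-> ->]; rewrite !absz_nat.
  have le : (minn t k <= k)%N by exact: geq_minr.
  split; apply: leq_trans N_le_bound; first by rewrite leq_exp2l.
  exact: leq_trans le (ltnW kN).
- by move=> t st tm [v0 v1 _ _] v2 h; exact: (pow_step p_pr m_gt1 m_le_p).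
apply: (run_phase (F := scale_fact p m)) k1 => [||||||st2 k2].
- by vm_compute.
- exact: len_bound.
- by apply: lenT; rewrite /=; lia.
- by [].
- move=> t v1 v2 /= t14 [-> ->]; split=> //; rewrite absz_nat leq_exp2l;
  first by lia.
  by have := Np_ge16; lia.
- by move=> t st tm [v0 v1 _ /= [hpow _]] v2 h;
  exact: (scale_step p_pr m_gt1 m_le_p).
apply: (run_phase (F := inv_fact p m)) k2 => [||||||st3 k3].
- by vm_compute.
- by apply: len_bound; rewrite /= -/U; lia.
- by apply: lenT; rewrite /=; lia.
- by move=> st [v0 _ _ _]; exact: ev_mul (ev_M v0).
- by move=> t v1 v2 _ /= [-> ->]; split; exact: phi_bound.
- by move=> t st tm [v0 v1 _ _] v2 h; exact: (inv_step p_pr m_gt1 m_le_p).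
apply: (run_phase (F := ifact_fact p m)) k3 => [||||||st4 k4].
- by vm_compute.
- by apply: len_bound; rewrite /= -/U; lia.
- by apply: lenT; rewrite /=; lia.
- by move=> st [v0 _ _ _]; exact: ev_M v0.
- by move=> t v1 v2 _ /= [-> ->]; split; exact: phi_bound.
- by move=> t st tm [v0 v1 _ /= [hinv _]] v2 h;
  exact: (ifact_step p_pr m_gt1 m_le_p).
apply: (run_phase (F := top_fact m)) k4 => [||||||st5 k5].
- by vm_compute.
- by apply: len_bound; rewrite /= -/U.
- by apply: lenT; rewrite /=; lia.
- by move=> st [v0 v1 _ /= [_ [_ [_ [hpow _]]]]]; exact: (ev_N p_pr m_gt1 m_le_p).
- move=> t v1 v2 tN /= [-> ->]; split=> //; rewrite absz_nat.
  case: eqP => // /eqP t0; apply: leq_trans N_le_bound; apply: leq_trans (ltnW tN).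
  by apply: trunc_logP; rewrite // lt0n.
- by move=> t st tm [v0 v1 _ _] v2 h; exact: (top_step p_pr m_gt1 m_le_p).
apply: (run_phase (F := tw_fact R p m)) k5 => [||||||st6 k6].
- by vm_compute.
- by apply: len_bound; rewrite /= -/U.
- by apply: lenT; rewrite /=; lia.
- by move=> st [v0 v1 _ /= [_ [_ [_ [_ [hpow _]]]]]];
  exact: (ev_N p_pr m_gt1 m_le_p).
- move=> t v1 v2 tN /= [/(_ k tN) h _].
  apply: (close_bounded h) (w_norm R m t) _.
    rewrite -natrX -natrM ler_nat; apply: leq_trans (scale_big p_pr m_gt1 m_le_p).
    have := expN 3 (leqnn k); have -> : (2 ^ 3 = 8)%N by [].
    have -> : (N ^ 12 = N ^ 3 * N ^ 9)%N by rewrite -expnD.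
    have : (0 < N ^ 9)%N by rewrite expn_gt0 N0.
    have : (0 < p ^ 2)%N by rewrite expn_gt0 prime_gt0.
    move: (8 ^ k)%N (N ^ 3)%N (N ^ 9)%N (p ^ 2)%N => x b c d d0 c0 xb.
    by have := leq_trans (leq_pmulr b c0) (leq_pmull (b * c) d0); lia.
  apply: leq_trans (_ : N ^ 4 <= _)%N;
    last by rewrite leq_pmulr // expn_gt0 prime_gt0.
  by apply: leq_trans (_ : N ^ 1 <= _)%N; [rewrite expn1; lia | rewrite leq_pexp2l].
- by move=> t st tm [v0 v1 _ /= [htop [_ [_ [hsc _]]]]] v2 h;
  exact: (tw_step p_pr m_gt1 m_le_p).
apply: (run_phase (F := coef_fact m f)) k6 => [||||||st7 k7].
- by vm_compute.
- by apply: len_bound; rewrite /= -/U.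
- by apply: lenT; rewrite /=; lia.
- move=> st [v0 v1 _ /= [_ [_ [_ [_ [_ [hpow _]]]]]]].
  by apply: ev_mul (ev_add (ev_M v0) _) (ev_N p_pr m_gt1 m_le_p v0 v1 hpow).
- by move=> t v1 v2 _ /= [-> ->]; split=> //; exact: phi_bound.
- move=> t st tm [v0 v1 _ /= [_ [_ [hif [hinv [_ [hpow [hin _]]]]]]]] v2 h.
  exact: (coef_step p_pr m_gt1 m_le_p).
apply: (run_phase (F := fwd_fact R m f)) k7 => [||||||st8 k8].
- by vm_compute.
- exact: len_bound.
- by apply: lenT; rewrite /= -/U; lia.
- move=> st [v0 v1 _ /= [_ [_ [_ [_ [_ [_ [hpow _]]]]]]]].
  apply: ev_mul (ev_mul (ev_add (ev_M v0) _) (ev_add _ _)) _ => //;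
    [exact: (ev_K p_pr m_gt1 m_le_p) | exact: (ev_N p_pr m_gt1 m_le_p)].
- move=> t v1 v2 _ /= h.
  have nb := fft_norm1 (w_norm R m) (fun j _ => @rowC_norm R p m f p_pr (t %/ N %/
    (k + 1)) j)
    (level_le m t) (pos_lt m t).
  rewrite -natrX -natrM in nb.
  apply: (close_bounded h) nb _.
    by rewrite ler_nat; apply: (fwd_small p_pr m_gt1 m_le_p); exact: level_le.
  apply: leq_mul; last by rewrite -{1}[p]expn1 leq_pexp2l // prime_gt0.
  by apply: leq_trans (expN 2 (level_le m t)) _; rewrite leq_pexp2l.
- move=> t st tm [v0 v1 _ /= [hco [htw [_ [_ [_ [hsc [hpow _]]]]]]]] v2 h.
  exact: (fwd_step p_pr m_gt1 m_le_p).
apply: (run_phase (F := bwd_fact R m f)) k8 => [||||||st9 k9].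
- by vm_compute.
- by apply: len_bound; rewrite /= !leq_mul2r leq_addr !orbT.
- apply: lenT; rewrite /=; apply: leq_trans (_ : U <= _)%N; last by lia.
  by rewrite !leq_mul2r leq_addr !orbT.
- move=> st [v0 v1 _ /= [_ [_ [_ [_ [_ [_ [_ [hpow _]]]]]]]]].
  apply: ev_mul (ev_mul (ev_M v0) (ev_add _ _)) _ => //;
    [exact: (ev_K p_pr m_gt1 m_le_p) | exact: (ev_N p_pr m_gt1 m_le_p)].
- move=> t v1 v2 _ /= h.
  have nb := @bwd_norm R p m f p_pr (t %/ N %/ (k + 1)) _ _ (level_le m t) (pos_lt
    m t).
  apply: (close_bounded h) nb _ => //; rewrite ler_nat.
  apply: leq_trans (ltnW (bwd_small p_pr m_gt1 m_le_p (level_le m t))).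
  by rewrite leq_pmull.
- move=> t st tm [v0 v1 _ /= [hfwd [_ [htw [_ [_ [_ [hsc [hpow _]]]]]]]]] v2 h.
  exact: (bwd_step p_pr m_gt1 m_le_p).
apply: (run_phase (F := val_fact m f)) k9 => [||||||st10 k10].
- by vm_compute.
- by apply: len_bound; rewrite /= -/U.
- by apply: lenT; rewrite /=; lia.
- by move=> st [v0 v1 _ _]; exact: ev_mul (ev_mul _ (ev_M v0)) (ev_M v0).
- move=> t v1 v2 _ /= [[n -> np] [_ ->]]; split=> //;
  exact: leq_trans (ltnW np) p_le_bound.
- move=> t st tm [v0 v1 _ /= [hbwd [_ [_ [_ [_ [hif [hinv [hsc [hpow [hin
  _]]]]]]]]]]] v2 h.
  exact: (val_step p_pr m_gt1 m_le_p _ _ _ _ _ _ _ _ _ hbwd).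
apply: (run_phase (F := sum_fact m f)) k10 => [||||||st11 k11].
- by vm_compute.
- by apply: len_bound; rewrite /= -/U.
- by apply: lenT; rewrite /=; lia.
- by move=> st [v0 v1 _ _]; exact: ev_mul (ev_mul _ (ev_M v0)) (ev_M v0).
- move=> t v1 v2 _ /= [[n -> np] [_ ->]]; split=> //;
  exact: leq_trans (ltnW np) p_le_bound.
- move=> t st tm [v0 v1 _ /= [hval _]] v2 h.
  exact: (sum_step p_pr m_gt1).
apply: (run_phase (F := out_fact m f)) k11 => [||||||st12 k12].
- by vm_compute.
- by apply: len_bound; rewrite /= -/U; lia.
- by apply: lenT; rewrite /=; lia.
- by move=> st [v0 v1 _ _]; exact: ev_mul _ (ev_M v0).
- by move=> t v1 v2 _ /= [-> ->]; split=> //; exact: phi_bound.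
- move=> t st tm [v0 v1 _ /= [hsum _]] v2 h.
  exact: (out_step p_pr m_gt1).
exists 1%N, st12; split; first exact: exec_skip.
  by rewrite mul1n (leq_ltn_trans (leq0n 0)) // lenT.
by case: k12 => _ _ _ [].
Qed.

End Run.

(** * Operation and bit counts in terms of n and p *)

Section Resources.
Variable m : nat.
Hypothesis m_gt1 : (1 < m)%N.

Lemma sizeN_lt_square : (sizeN m < (m ^ 2) ^ 2)%N.
Proof.
apply: leq_trans (sizeN_lt m_gt1) _; rewrite -expnM (expnS m 3) mulnC leq_mul2l.
by apply/orP; right; apply: leq_trans (_ : 2 ^ 3 <= _)%N; rewrite ?leq_exp2r.
Qed.

Lemma lgN_log : (lgN m + 1 <= 2 * up_log 2 (m ^ 2))%N.
Proof.
rewrite addn1 -(@ltn_exp2l 2) // -/(sizeN m); apply: leq_trans sizeN_lt_square _.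
by rewrite mulnC expnM leq_exp2r // up_logP.
Qed.

Lemma time_unit_bound : (time_unit m <= 480 * (m ^ 2 * up_log 2 (m ^ 2)))%N.
Proof.
have h1 := lgN_log; have h2 := ltnW (sizeN_lt m_gt1); rewrite /time_unit.
have h3 : (m + 1 <= 2 * m)%N by lia.
apply: leq_trans (_ : 20 * (2 * m) * (2 * up_log 2 (m ^ 2)) * (6 * m) <= _)%N.
  by rewrite !leq_mul.
by rewrite expnS expn1; move: (up_log _ _) => u; apply: eq_leq; ring.
Qed.

(** From [N < n^2] for [n = m ^ 2] one gets [N p < (n p)^2], which has [2 (u + v)] bits; the power
    [20 D] gives the constant [40 D]. *)
Lemma mem_bound_bits p D C : prime p -> (0 < D)%N -> (40 * D <= C)%N ->
  (mem_bound p m ^ D < 2 ^ (C * (up_log 2 (m ^ 2) + up_log 2 p)))%N.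
Proof.
move=> p_pr D0 DC; set u := up_log 2 (m ^ 2); set v := up_log 2 p.
apply: leq_trans (_ : 2 ^ (2 * (u + v) * (20 * D)) <= _)%N; last first.
  by rewrite leq_exp2l // mulnAC leq_mul2r mulnA (_ : 2 * 20 = 40)%N // DC orbT.
rewrite /mem_bound -expnM [(2 ^ (_ * (20 * D)))%N]expnM ltn_exp2r ?muln_gt0 //.
apply: leq_trans (_ : (m ^ 2) ^ 2 * p ^ 2 <= _)%N.
  apply: leq_ltn_trans (_ : sizeN m * p ^ 2 < _)%N.
    by rewrite leq_mul2l -{1}[p]expn1 leq_pexp2l ?prime_gt0 ?orbT.
  by rewrite ltn_mul2r expn_gt0 prime_gt0 // sizeN_lt_square.
rewrite -expnMn [(2 * (u + v))%N]mulnC expnM leq_exp2r // expnD.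
by rewrite leq_mul ?up_logP.
Qed.

End Resources.

Local Close Scope ring_scope.

Theorem theorem1 :
  exists (prover : cmd) (C : nat),
  forall (p n m : nat) (a : 'M['F_p]_m) (f : {poly {poly 'F_p}}),
    prime p -> n = (m ^ 2)%N -> (1 < n)%N ->
    unique (interpolates a) f ->
    exists (t : nat) (st : state),
      [/\ exec (C * (up_log 2 n + up_log 2 p)) prover (input_state a) t st,
          (t <= C * (n * up_log 2 n))%N &
          output_seq (2 * m) st = honest_message m f].
Proof.
(* The first summand pays for the word length and the second for the time. *)
exists prover, (40 * degree_bound + 480 * prover_cost)%N.
move=> p n m a f p_pr nE n1 fU; rewrite {}nE in n1 *.
have m_gt1 : (1 < m)%N by case: m a fU n1 => [|[]].
have m_le_p := unique_interpolation_side p_pr fU; have [fP _] := fU.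
have BW := mem_bound_bits m_gt1 p_pr (isT : 0 < degree_bound)%N
  (leq_addr (480 * prover_cost) (40 * degree_bound)).
have [t [st [ex tT out]]] := prover_run p_pr m_gt1 m_le_p fP BW.
exists t, st; split=> //.
  apply: leq_trans tT _; rewrite mulnDl (leq_trans _ (leq_addl _ _)) //.
  by rewrite [(480 * prover_cost)%N]mulnC -mulnA leq_mul2l time_unit_bound ?orbT.
rewrite /output_seq /honest_message; apply/eq_in_map => j;
  rewrite mem_iota add0n => /andP[_ jm].
by have [] := out j jm.
Qed.
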